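(* Let $\tau=\frac12(\sqrt5+1)$ and consider the golden Bernoulli convolution, i.e. the multivalued map $G=\{g_0,g_1\}$ on $[0,1]$ with $g_0(x)=\tau x$ on $[0,1/\tau]$ and $g_1(x)=\tau x+1-\tau$ on $[1-1/\tau,1]$. Let $F_1=F_2=1,\ F_3=2,\dots$ denote the Fibonacci numbers. For each $k\ge 1$, with odd period $p=2k-1$, the golden Bernoulli convolution admits a prime cycle mixture of period $p$ with $n=4k-3$ vertices and $m=F_{k+1}$ cycles. For $k\to\infty$ the growth rates $\rho_k=\sqrt[p]{m}$ of these orbits converge to the maximum growth rate $\sqrt{\tau}$. This maximum growth rate is realized by the orbit network of the point $x=\frac{2\tau-1}{5}=\frac1{\sqrt5}$, which is a mixture of $3$ cycles of period $4$ without root.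
   Context: For $x\in[0,1]$ the set of immediate successors is $G(x)=\{g_i(x): i\in\{0,1\},\ x \text{ in the domain of } g_i\}$, and $G^0(x)=\{x\}$, $G^{q}(x)=G(G^{q-1}(x))$. The orbit of $x$ is $O(x)=\bigcup_{q\ge 0}G^q(x)$. A finite orbit is regarded as a directed graph (network): the vertices are its points, and there is an edge (labelled $i$) from $y$ to $g_i(y)$ whenever $y$ is in the domain of $g_i$. A directed graph is a mixture of cycles of period $p$ if all minimal directed cycles in the graph have length $p$ and each edge is contained in a cycle. The number of cycles means the number of minimal directed cycles. A vertex contained in all cycles of the mixture is called a root. A cycle mixture is prime if it contains exactly one root vertex. The Bernoulli convolution ''admits'' a cycle mixture if the orbit network of some point of $[0,1]$ is such a mixture. Let $\gamma^q(x)$ be the number of $q$-th generation successors of $x$ counted with multiplicity, i.e. the number of words $w_1\dots w_q\in\{0,1\}^q$ for which $g_{w_q}\cdots g_{w_1}(x)$ is defined. The growth rate (growth factor) of $x$ is $\lambda_x=\lim_{q\to\infty}\sqrt[q]{\gamma^q(x)}$ when the limit exists. The growth rate of a cycle mixture with root is the growth rate of its root. The maximum growth rate is the maximum of the growth rates of points $x\in[0,1]$. *)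

(* Defs.v *)
From HB Require Import structures.
From mathcomp Require Import all_boot all_order all_algebra.
From mathcomp Require Import all_classical all_reals all_analysis.

Set Implicit Arguments.
Unset Strict Implicit.
Unset Printing Implicit Defensive.

Import Order.TTheory GRing.Theory Num.Theory.
Import numFieldNormedType.Exports.

Local Open Scope classical_set_scope.
Local Open Scope card_scope.
Local Open Scope ring_scope.

Fixpoint fib (n : nat) : nat :=
  match n with
  | 0 => 0
  | 1 => 1
  | (m.+1 as k).+1 => fib k + fib m
  end.

Section Networks.
Variable T : eqType.

Record network := Network { vertices : set T ; edge : rel T }.

Implicit Types (N : network) (c : seq T).

(* A minimal directed cycle is a closed walk without repeated vertices, given
   by the list of its vertices from an arbitrary starting point; loops are
   cycles of length 1. *)
Definition min_cycle N c : Prop :=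
  [/\ c != [::], (forall y, y \in c -> vertices N y), uniq c & cycle (edge N) c].

(* The edge set does not depend on the starting point and determines a cycle
   without repeated vertices, so cycles are counted through their edge sets. *)
Definition cycle_edges c : set (T * T) := [set (y, next c y) | y in [set` c]].

Definition min_cycles N : set (set (T * T)) :=
  [set cycle_edges c | c in min_cycle N].

Definition cycle_mixture (p : nat) N : Prop :=
  [/\ finite_set (vertices N),
      (forall c, min_cycle N c -> size c = p) &
      forall y z, vertices N y -> vertices N z -> edge N y z ->
        exists2 c, min_cycle N c & cycle_edges c (y, z)].

Definition root_vertex N (r : T) : Prop :=
  vertices N r /\ forall c, min_cycle N c -> r \in c.

Definition prime_cycle_mixture (p : nat) N : Prop :=
  cycle_mixture p N /\ exists! r, root_vertex N r.

End Networks.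

Section GoldenBernoulliConvolution.
Variable R : realType.

Definition tau : R := (Num.sqrt 5 + 1) / 2.

(* The index false stands for 0 and true for 1. *)
Definition g (i : bool) (x : R) : R :=
  if i then tau * x + 1 - tau else tau * x.

Definition gdom (i : bool) (x : R) : bool :=
  if i then 1 - tau^-1 <= x <= 1 else 0 <= x <= tau^-1.

Definition succs (A : set R) : set R :=
  [set z | exists2 y, A y & exists2 i, gdom i y & z = g i y].

Definition generation (q : nat) (x : R) : set R := iter q succs [set x].

Definition orbit_set (x : R) : set R := \bigcup_q generation q x.

(* Since tau != 1, g false y and g true y are always distinct, so the labels of
   the edges are determined by their endpoints and there are no parallel
   edges: the network is a plain directed graph. *)
Definition orbit_network (x : R) : network R :=
  Network (orbit_set x) [rel y z | [exists i : bool, gdom i y && (z == g i y)]].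

(* The first letter of the word is applied first. *)
Fixpoint admissible (w : seq bool) (x : R) : bool :=
  if w is i :: w' then gdom i x && admissible w' (g i x) else true.

Definition num_successors (q : nat) (x : R) : nat :=
  #|[pred w : q.-tuple bool | admissible w x]|.

Definition growth_rate (x lambda : R) : Prop :=
  (num_successors q x)%:R `^ (q%:R^-1) @[q --> \oo] --> lambda.

Definition max_growth_rate (lambda : R) : Prop :=
  (exists2 x : R, 0 <= x <= 1 & growth_rate x lambda) /\
  (forall x l : R, 0 <= x <= 1 -> growth_rate x l -> l <= lambda).

Definition network_growth_rate (N : network R) (lambda : R) : Prop :=
  exists2 r, root_vertex N r & growth_rate r lambda.

Definition rho (k : nat) : R := (fib k.+1)%:R `^ ((2 * k - 1)%N%:R^-1).

End GoldenBernoulliConvolution.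

(* Main.v *)
(* At points of [1 / t ^ 2, 1 / t] both maps apply; everywhere else exactly
   one does (t denotes the golden mean).  Two successors of the same
   generation either merge again through the relation g_0 g_0 g_1 = g_1 g_1
   g_0, or are replaced by another pair at the same distance, their
   multiplicities (a, b) becoming (a, a + b) or (a + b, b).  A weight on (a,
   b) that grows by the factor t per two steps bounds the growth rate of
   every point by sqrt t.  Alternating the two kinds of replacement k - 2
   times and then merging at the starting point gives, for a suitable
   starting point, an orbit that returns to this point after 2 k - 1 steps:
   its minimal cycles correspond to the words leading back, and the
   Fibonacci numbers are the alternating multiplicities.  For the orbit of 1
   / sqrt 5 the alternation never stops. *)

Require Import Defs.
From HB Require Import structures.
From mathcomp Require Import all_boot all_order all_algebra.
From mathcomp Require Import all_classical all_reals all_analysis.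
From mathcomp Require Import ring lra zify.

Set Implicit Arguments.
Unset Strict Implicit.
Unset Printing Implicit Defensive.

Import Order.TTheory GRing.Theory Num.Theory.
Import numFieldNormedType.Exports.

Local Open Scope classical_set_scope.
Local Open Scope card_scope.
Local Open Scope ring_scope.

(** * Arithmetic of the golden mean and the branching recursion for successor counts *)

Section Tau.
Variable R : realType.
Local Notation t := (tau R).

Lemma tau_sqr : t * t = t + 1.
Proof.
have h5 : Num.sqrt 5 * Num.sqrt 5 = 5 :> R by rewrite -expr2 sqr_sqrtr.
rewrite /tau; lra.
Qed.

Lemma tau_bounds : 1618 / 1000 < t < 1619 / 1000.
Proof.
have h5 : Num.sqrt 5 * Num.sqrt 5 = 5 :> R by rewrite -expr2 sqr_sqrtr.
have h0 : 0 <= Num.sqrt 5 :> R by exact: sqrtr_ge0.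
rewrite /tau; apply/andP; split; nra.
Qed.

Lemma tauV : t^-1 = t - 1.
Proof.
have := tau_sqr; have /andP[h _] := tau_bounds => h2.
have t0 : t != 0 by apply: lt0r_neq0; lra.
by apply: (mulfI t0); rewrite divff // mulrBr h2; ring.
Qed.

(* Interval bounds are kept linear in t: t - 1 = 1 / t, 2 - t = 1 / t ^ 2,
   2 * t - 3 = 1 / t ^ 3 and 5 - 3 * t = 1 / t ^ 4. *)
Lemma gdom0 (x : R) : gdom false x = (0 <= x <= t - 1).
Proof. by rewrite /= tauV. Qed.

Lemma gdom1 (x : R) : gdom true x = (2 - t <= x <= 1).
Proof. by rewrite /= tauV opprB addrA -natr1. Qed.

Definition gdomE := (gdom0, gdom1).

Lemma g_neq (x : R) : g false x != g true x.
Proof.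
have /andP[h1 h2] := tau_bounds.
by rewrite /g; apply/eqP => h; lra.
Qed.

Lemma gdom_total (x : R) : 0 <= x <= 1 -> exists i, gdom i x.
Proof.
move=> /andP[x0 x1]; have /andP[h1 h2] := tau_bounds.
have [h|h] := leP x (t - 1); [exists false|exists true]; rewrite gdomE; lra.
Qed.

Lemma gdom_itv i (x : R) : gdom i x -> 0 <= g i x <= 1.
Proof.
have /andP[h1 h2] := tau_bounds; have h3 := tau_sqr.
by case: i; rewrite gdomE /g => /andP[? ?]; nra.
Qed.

Local Notation f := (@num_successors R).

Lemma num_successors0 x : f 0 x = 1%N.
Proof.
rewrite /num_successors -[RHS](card_tuple 0 bool); apply: eq_card => w.
by rewrite !inE tuple0.
Qed.

(** Words are split by their first letter. *)
Lemma num_successorsS q x :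
  f q.+1 x = (gdom false x * f q (g false x) + gdom true x * f q (g true x))%N.
Proof.
have E i : (gdom i x * f q (g i x))%N =
    \sum_(w : q.-tuple bool) (admissible (i :: w) x : nat).
  rewrite /num_successors -sum1_card big_mkcond big_distrr.
  apply: eq_bigr => w _; rewrite inE [admissible (_ :: _) _]/=.
  by case: (gdom i x); case: (admissible w _).
rewrite !E /num_successors -sum1_card big_mkcond.
pose h (iw : bool * q.-tuple bool) := [tuple of iw.1 :: iw.2].
pose h' (w : q.+1.-tuple bool) := (thead w, [tuple of behead w]).
have bh : {on predT, bijective h}.
  exists h' => [[i w]|w] _; first by congr pair; apply: val_inj.
  by apply: val_inj => /=; rewrite [w in RHS]tuple_eta.
rewrite (reindex h) //= -(pair_bigA _ (fun i w => if (h (i, w) \in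
  [pred w : q.+1.-tuple bool | admissible w x]) then 1 else 0)%N) /=.
rewrite big_bool addnC.
by congr addn; apply: eq_bigr => w _; rewrite inE; case: ifP => /=.
Qed.

End Tau.

(** * Growth of the number of successors *)

Section UpperBound.
Variable R : realType.
Local Notation t := (tau R).
Local Notation s := (Num.sqrt (tau R)).
Local Notation f := (@num_successors R).

Lemma num_successors_low q (x : R) :
  0 <= x < 2 - t -> f q.+1 x = f q (t * x).
Proof.
move=> /andP[x0 x1]; have /andP[h1 h2] := tau_bounds R.
rewrite num_successorsS !gdomE.
have -> : (0 <= x <= t - 1) = true by lra.
have -> : (2 - t <= x <= 1) = false by apply/negP => /andP[]; lra.
by rewrite mul1n mul0n addn0.
Qed.

Lemma num_successors_high q (x : R) :
  t - 1 < x <= 1 -> f q.+1 x = f q (t * x + 1 - t).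
Proof.
move=> /andP[x0 x1]; have /andP[h1 h2] := tau_bounds R.
rewrite num_successorsS !gdomE.
have -> : (0 <= x <= t - 1) = false by apply/negP => /andP[]; lra.
have -> : (2 - t <= x <= 1) = true by lra.
by rewrite mul1n mul0n.
Qed.

Lemma num_successors_mid q (x : R) : 2 - t <= x <= t - 1 ->
  f q.+1 x = (f q (t * x + 1 - t) + f q (t * x))%N.
Proof.
move=> /andP[x0 x1]; have /andP[h1 h2] := tau_bounds R.
rewrite num_successorsS !gdomE.
have -> : (0 <= x <= t - 1) = true by lra.
have -> : (2 - t <= x <= 1) = true by lra.
by rewrite !mul1n addnC.
Qed.

Lemma num_successors_at0 q : f q 0 = 1%N.
Proof.
have /andP[h1 h2] := tau_bounds R.
elim: q => [|q IH]; first exact: num_successors0.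
by rewrite (@num_successors_low _ 0) ?mulr0 //; lra.
Qed.

Lemma num_successors_at1 q : f q 1 = 1%N.
Proof.
have /andP[h1 h2] := tau_bounds R.
elim: q => [|q IH]; first exact: num_successors0.
rewrite (@num_successors_high _ 1); last by lra.
have -> : t * 1 + 1 - t = 1 by lra.
exact: IH.
Qed.

Lemma num_successors_le q (x : R) : (f q x <= 2 ^ q)%N.
Proof.
by rewrite /num_successors (leq_trans (max_card _)) // card_tuple card_bool.
Qed.

Lemma num_successors_gt0 q (x : R) : 0 <= x <= 1 -> (0 < f q x)%N.
Proof.
elim: q x => [|q IH] x x01; first by rewrite num_successors0.
rewrite num_successorsS addn_gt0 !muln_gt0.
have [i di] := gdom_total x01; have := IH _ (gdom_itv di).
by case: i di => -> ->; rewrite ?orbT.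
Qed.

Lemma sqrt_tau_sqr : s * s = t.
Proof.
have /andP[h1 h2] := tau_bounds R.
by rewrite -expr2 sqr_sqrtr //; lra.
Qed.

Lemma sqrt_tau_bounds : 1272 / 1000 < s < 1273 / 1000.
Proof.
have /andP[h1 h2] := tau_bounds R; have h := sqrt_tau_sqr.
have := sqrtr_ge0 t => ?; apply/andP; split; nra.
Qed.

Lemma sqrt_tau_pow_ge1 q : 1 <= s ^+ q.
Proof. by have /andP[? _] := sqrt_tau_bounds; apply: exprn_ege1; lra. Qed.

(** For [0 < y < 2 - t] the pair lies on both sides of the branching interval and nothing branches.
    For [y = 0] or [y = 2 - t] one point is an endpoint of that interval, and its extra successor is
    the fixed point 1 or 0; [C] pays for this one extra word. *)
Lemma num_successors_far_pair q (y a b C : R) : 0 <= y <= 2 - t ->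
  a <= C -> b <= C -> 0 <= C ->
  a * (f q.+1 y)%:R + b * (f q.+1 (y + t - 1))%:R <=
  a * (f q (t * y))%:R + b * (f q (t * y + 2 - t))%:R + C.
Proof.
move=> /andP[y0 y1] aC bC C0.
have /andP[h1 h2] := tau_bounds R; have h3 := tau_sqr R.
have -> : t * y + 2 - t = t * (y + t - 1) + 1 - t by lra.
have [yl|yl] := ltP y (2 - t).
  rewrite (@num_successors_low _ y) ?y0 //.
  have [yp|yp] := ltP 0 y.
    rewrite (@num_successors_high _ (y + t - 1)); last by lra.
    by rewrite lerDl.
  have -> : y = 0 by apply/eqP; rewrite eq_le yp.
  rewrite (@num_successors_mid _ (0 + t - 1)); last by lra.
  have -> : t * (0 + t - 1) = 1 by lra.
  rewrite num_successors_at1 natrD; lra.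
have -> : y = 2 - t by apply/eqP; rewrite eq_le y1.
rewrite (@num_successors_high _ (2 - t + t - 1)); last by lra.
rewrite (@num_successors_mid _ (2 - t)); last by lra.
have -> : t * (2 - t) + 1 - t = 0 by lra.
rewrite num_successors_at0 natrD; lra.
Qed.

(** [g false u] and [g true (u + 2 - t)] coincide in [t * u]. The Boolean factors tell which point,
    if any, has a second successor; that one is at distance 1 / t from [t * u]. *)
Lemma num_successors_near_pair q (u : R) : 0 <= u <= t - 1 ->
  f q.+1 u = (f q (t * u)%R + (2 - t <= u)%R * f q (t * u + 1 - t)%R)%N /\
  f q.+1 (u + 2 - t) =
    (f q (t * u)%R + (u <= 2 * t - 3)%R * f q (t * u + t - 1)%R)%N.
Proof.
have /andP[h1 h2] := tau_bounds R; have h3 := tau_sqr R.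
move=> /andP[u0 u1].
have e1 : t * (u + 2 - t) + 1 - t = t * u by lra.
have e2 : t * (u + 2 - t) = t * u + t - 1 by lra.
split.
  have [ul|ul] := leP (2 - t) u.
    by rewrite (@num_successors_mid _ u) ?ul // mul1n addnC.
  by rewrite (@num_successors_low _ u) ?u0 // mul0n addn0.
have [ul|ul] := leP u (2 * t - 3).
  by rewrite (@num_successors_mid _ (u + 2 - t)) ?e1 ?e2 ?mul1n //; lra.
by rewrite (@num_successors_high _ (u + 2 - t)) ?e1 ?mul0n ?addn0 //; lra.
Qed.

(** The weight of [(a, b)] is compared with those of [(a, a + b)], [(a + b, b)] and
    [(a + b, a + b)]. The golden relation gives [a + c * (a + b) = c * (c * a + b)]; the factor 2
    comes from adding the two bounds by [M]. *)
Lemma pair_weight_step (F : realFieldType) (c a b M : F) :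
  1 <= c <= 2 -> c * c = c + 1 -> 0 <= a -> 0 <= b ->
  c * a + b <= M -> a + c * b <= M ->
  [/\ c * a + (a + b) <= c * M /\ a + c * (a + b) <= c * M,
      c * (a + b) + b <= c * M /\ a + b + c * b <= c * M,
      c * (a + b) + (a + b) <= 2 * M,
      a <= (c - 1) * M /\ b <= (c - 1) * M &
      a + b <= M].
Proof.
move=> /andP[c1 c2] cc a0 b0 Ma Mb.
have c0 : 0 <= c by lra.
have d0 : 0 <= c - 1 by lra.
have cb := ler_wpM2l d0 b0; have ca := ler_wpM2l d0 a0.
have cMa := ler_wpM2l c0 Ma; have cMb := ler_wpM2l c0 Mb.
have dMa := ler_wpM2l d0 Ma; have dMb := ler_wpM2l d0 Mb.
have cca : c * c * a = (c + 1) * a by rewrite cc.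
have ccb : c * c * b = (c + 1) * b by rewrite cc.
by split; [split; lra|split; lra|lra|split; lra|lra].
Qed.

Lemma tau_mul_le (a b : R) : a <= b -> t * a <= t * b.
Proof. by have /andP[? _] := tau_bounds R; move=> ab; rewrite ler_wpM2l //; lra. Qed.

(* Two successors at distance 1/t, with multiplicities a and b, become after
   two steps another such pair with multiplicities (a, a + b) or (a + b, b),
   or a single point of multiplicity a + b which branches again one step
   later.  The weight max (t a + b, a + t b) grows by at most t in the first
   two cases and by at most 2 < t ^ (3 / 2) in the last one; the summand -1
   absorbs the extra branches that end at the fixed points 0 and 1. *)
Lemma num_successors_pair_le q (y a b M : R) : 0 <= y <= 2 - t ->
  0 <= a -> 0 <= b -> t * a + b <= M -> a + t * b <= M ->
  a * (f q y)%:R + b * (f q (y + t - 1))%:R <= (5 * s ^+ q - 1) * M.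
Proof.
elim/ltn_ind: q y a b M => q IH y a b M /andP[y0 y1] a0 b0 Ma Mb.
have h3 := tau_sqr R.
have t12 : 1 <= t <= 2 by have /andP[h1 h2] := tau_bounds R; clear -h1 h2; lra.
have [[P1 P2] [P3 P4] P5 [aM bM] abM] := pair_weight_step t12 h3 a0 b0 Ma Mb.
have ab0 := addr_ge0 a0 b0; have M0 := le_trans ab0 abM.
(* The induction descends by two or three steps; below 3 there are at most 4 words, and
   [5 * s ^+ q - 1] is at least 4. *)
have [q3|q3] := ltnP q 3.
  have fle x : (f q x)%:R <= 4 :> R.
    rewrite (ler_nat _ _ 4) (leq_trans (num_successors_le _ _)) //.
    by rewrite (@leq_pexp2l 2 q 2).
  have H1 := ler_wpM2l a0 (fle y); have H2 := ler_wpM2l b0 (fle (y + t - 1)).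
  have := ler_wpM2r M0 (sqrt_tau_pow_ge1 q); clear -H1 H2 abM; lra.
case: q q3 IH => [//|[//|[//|q]]] _ IH.
have sqSSS : s ^+ q.+3 = t * s ^+ q.+1 by rewrite 2!exprS mulrA sqrt_tau_sqr.
have u1 : t * y <= t - 1 by have := tau_mul_le y1; clear -h3; lra.
have u0 : 0 <= t * y by have := tau_mul_le y0; rewrite mulr0.
(* Here [C] is [(t - 1) * M]: two steps turn the summand -1 of the bound into -t, and the difference
   is exactly this cost. *)
apply: le_trans (@num_successors_far_pair q.+2 y _ _ _ _ aM bM _) _.
- by rewrite y0.
- by apply: mulr_ge0 => //; exact: le_trans u0 u1.
move: (t * y) u0 u1 => u u0 u1 {y y0 y1 aM bM abM Ma Mb}.
have tul : t * u <= 1 by have := tau_mul_le u1; clear -h3; lra.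
have tu0 : 0 <= t * u by have := tau_mul_le u0; rewrite mulr0.
have [] := @num_successors_near_pair q.+1 u; first by rewrite u0.
have /andP[h1 h2] := tau_bounds R.
(* The lower point branches: multiplicities [(a, a + b)]. *)
have [ul|ul] := leP (2 - t) u.
  have -> : (u <= 2 * t - 3) = false by apply/negP; clear -ul h2; lra.
  rewrite mul1n mul0n addn0 => -> ->.
  have tul' : t - 1 <= t * u by have := tau_mul_le ul; clear -h3; lra.
  have H : a * (f q.+1 (t * u + 1 - t))%:R + (a + b) *
      (f q.+1 (t * u + 1 - t + t - 1))%:R <= (5 * s ^+ q.+1 - 1) * (t * M).
    by apply: IH => //; clear -tul tul'; lra.
  move: H; have -> : t * u + 1 - t + t - 1 = t * u by ring.
  rewrite sqSSS natrD => H; clear -H; lra.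
(* The upper point branches: multiplicities [(a + b, b)]. *)
have [ul'|ul'] := leP u (2 * t - 3).
  rewrite mul1n mul0n addn0 => -> ->.
  have tul' : t * u <= 2 - t by have := tau_mul_le ul'; clear -h3; lra.
  have H : (a + b) * (f q.+1 (t * u))%:R + b * (f q.+1 (t * u + t - 1))%:R
    <= (5 * s ^+ q.+1 - 1) * (t * M).
    by apply: IH => //; rewrite tu0.
  rewrite sqSSS natrD; clear -H; lra.
(* Neither branches: both merge in [t * u], which then splits into a pair with multiplicities
   [(a + b, a + b)]. Three steps cost a factor 2, at most [s ^+ 3 = t * s]. *)
rewrite !mul0n !addn0 => -> ->.
have ts : 2 <= t * s by have /andP[s1 s2] := sqrt_tau_bounds; clear -s1 h1; nra.
have tu1 : 2 - t <= t * u by have := tau_mul_le (ltW ul'); clear -h3; lra.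
have tu2 : t * u <= t - 1 by have := tau_mul_le (ltW ul); clear -h3; lra.
rewrite (@num_successors_mid _ (t * u)) ?tu1 //.
have H : (a + b) * (f q (t * (t * u) + 1 - t))%:R + (a + b) *
    (f q (t * (t * u) + 1 - t + t - 1))%:R <= (5 * s ^+ q - 1) * (2 * M).
  apply: IH => //; first exact: leqW (leqnSn _).
  - by have := tau_mul_le tu1; have := tau_mul_le tu2; clear -h3; lra.
  - by rewrite [leLHS]addrC.
move: H; have -> : t * (t * u) + 1 - t + t - 1 = t * (t * u) by ring.
have sM : 0 <= (t * s - 2) * (s ^+ q * M).
  apply: mulr_ge0; first by rewrite subr_ge0.
  by rewrite mulr_ge0 ?exprn_ge0 ?sqrtr_ge0.
have tM : t * M <= 2 * M by rewrite ler_wpM2r //; clear -h2; lra.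
rewrite sqSSS exprS natrD => H; clear -H sM tM; lra.
Qed.

Lemma num_successors_upper q (x : R) : 0 <= x <= 1 ->
  (f q x)%:R <= 15 * s ^+ q.
Proof.
have /andP[h1 h2] := tau_bounds R; have h3 := tau_sqr R.
move=> /andP[x0 x1].
have sq := sqrt_tau_pow_ge1 q.
(* Outside the interior of the branching interval, [x] counts as one point of a pair whose other
   multiplicity is 0. *)
have [xl|xl] := leP x (2 - t).
  by have := @num_successors_pair_le q x 1 0 2; lra.
have [xm|xm] := leP (t - 1) x.
  have := @num_successors_pair_le q (x - t + 1) 0 1 2.
  have -> : x - t + 1 + t - 1 = x by lra.
  lra.
(* Inside it, one step gives a pair with multiplicities (1, 1) and weight [t + 1 <= 3]; hence the
   constant 15 = 5 * 3. *)
case: q sq => [|q] sq; first by rewrite num_successors0; lra.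
have sq' := sqrt_tau_pow_ge1 q.
rewrite (@num_successors_mid _ x); last by lra.
have := @num_successors_pair_le q (t * x + 1 - t) 1 1 3.
have -> : t * x + 1 - t + t - 1 = t * x by ring.
have /andP[s1 s2] := sqrt_tau_bounds.
have tx1 : t * x <= 1 by have := tau_mul_le (ltW xm); clear -h3; lra.
have tx0 : t - 1 <= t * x by have := tau_mul_le (ltW xl); clear -h3; lra.
have : 0 <= (s - 1) * s ^+ q by rewrite mulr_ge0 //; clear -s1; lra.
rewrite exprS natrD; clear -tx0 tx1 sq' h2; lra.
Qed.

End UpperBound.

(** * Limits of roots and the growth of the Fibonacci numbers *)

Section RootGrowth.
Variable R : realType.

Lemma cvg_invn : (n%:R^-1 : R) @[n --> \oo] --> (0 : R).
Proof. by rewrite -cvg_shiftS; exact: cvg_harmonic. Qed.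

Lemma cvg_root_cst (C : R) : 0 < C -> C `^ (n%:R^-1) @[n --> \oo] --> (1 : R).
Proof.
move=> C0; rewrite -[X in _ --> X]expR0.
have -> : (fun n : nat => C `^ n%:R^-1) = (fun n => expR (n%:R^-1 * ln C)).
  by apply: funext => n; rewrite /powR gt_eqF.
apply: continuous_cvg; first exact: continuous_expR.
by rewrite -[X in _ --> X](mul0r (ln C)); apply: cvgMl; exact: cvg_invn.
Qed.

Lemma powR_root_scale (C l : R) n : 0 <= C -> 0 <= l -> (0 < n)%N ->
  (C * l ^+ n) `^ (n%:R^-1) = C `^ n%:R^-1 * l.
Proof.
move=> C0 l0 n0; rewrite powRM ?exprn_ge0 //.
by rewrite -powR_mulrn // -powRrM divff ?powRr1 // pnatr_eq0 -lt0n.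
Qed.

(** The roots of [c] and [C] tend to 1, so the limit is squeezed. The exponent [phi] covers both all
    word lengths and the odd periods. *)
Lemma cvg_root (phi : nat -> nat) (F : nat -> R) (c C l : R) :
  0 < c -> 0 < C -> 0 <= l -> phi k @[k --> \oo] --> \oo ->
  (\forall k \near \oo, c * l ^+ phi k <= F k <= C * l ^+ phi k) ->
  F k `^ (phi k)%:R^-1 @[k --> \oo] --> l.
Proof.
move=> c0 C0 l0 hphi hF.
have lim (K : R) : 0 < K -> K `^ (phi k)%:R^-1 * l @[k --> \oo] --> l.
  move=> K0; rewrite -[X in _ --> X](mul1r l); apply: cvgMl.
  exact: (cvg_comp _ _ hphi (cvg_root_cst K0)).
apply: squeeze_cvgr (lim c c0) (lim C C0).
have p0 : \forall k \near \oo, (0 < phi k)%N.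
  by apply: (hphi [set n | (0 < n)%N]); exists 1%N.
near=> k.
have k0 : (0 < phi k)%N by near: k.
have /andP[h1 h2] : c * l ^+ phi k <= F k <= C * l ^+ phi k by near: k.
have c1 : 0 <= c * l ^+ phi k by rewrite mulr_ge0 ?exprn_ge0 // ltW.
rewrite -!powR_root_scale ?(ltW c0) ?(ltW C0) //.
by rewrite !ge0_ler_powR ?invr_ge0 ?nnegrE ?(le_trans c1 h1) //
  (le_trans c1 (le_trans h1 h2)).
Unshelve. all: by end_near.
Qed.

Lemma growth_rate_le_sqrt_tau (x l : R) : 0 <= x <= 1 -> growth_rate x l ->
  l <= Num.sqrt (tau R).
Proof.
move=> x01 hl; have s0 := sqrtr_ge0 (tau R).
have K0 : (0 : R) < 15 by [].
have lim : 15 `^ n%:R^-1 * Num.sqrt (tau R) @[n --> \oo] --> Num.sqrt (tau R).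
  rewrite -[X in _ --> X](mul1r (Num.sqrt (tau R))); apply: cvgMl.
  exact: cvg_root_cst.
apply: (ler_cvg_to hl lim); near=> n.
have n0 : (0 < n)%N by near: n; exists 1%N.
rewrite -powR_root_scale // ge0_ler_powR ?invr_ge0 ?nnegrE //.
exact: num_successors_upper.
Unshelve. all: by end_near.
Qed.

(** Powers of the golden mean obey the Fibonacci recursion, so both bounds propagate. *)
Lemma fib_bounds n : (tau R) ^+ n <= (fib n.+2)%:R <= tau R ^+ n.+1.
Proof.
have /andP[h1 h2] := tau_bounds R; have h3 := tau_sqr R.
have fibSS k : (fib k.+2)%:R = (fib k.+1)%:R + (fib k)%:R :> R.
  by rewrite -natrD.
elim/ltn_ind: n => -[|[|n]] IH.
- by rewrite expr0 expr1 /=; lra.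
- by rewrite expr1 expr2 /= h3; lra.
have /andP[a1 a2] := IH n.+1 (ltnSn _).
have /andP[b1 b2] := IH n (leqW (ltnSn _)).
have e k : tau R ^+ k.+2 = tau R ^+ k.+1 + tau R ^+ k.
  by rewrite !exprS mulrA h3 mulrDl mul1r.
by rewrite fibSS (e n) (e n.+1) !lerD.
Qed.

Lemma cvg_rho : rho R k @[k --> \oo] --> Num.sqrt (tau R).
Proof.
have /andP[h1 h2] := tau_bounds R; have h3 := tau_sqr R.
have /andP[s1 s2] := sqrt_tau_bounds R; have ss := sqrt_tau_sqr R.
(* After an index shift, [sqrt tau * tau ^+ k] is compared with a number between [tau ^+ k] and
   [tau ^+ k.+1]; the constants fit because [sqrt tau] lies between 1 and 2 and [tau] is at most
   2. *)
apply: (@cvg_root _ _ (1/2) 2).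
- by lra.
- by [].
- exact: sqrtr_ge0.
- apply: (cvg_comp (fun k => (2 * k)%N) (fun k => (k - 1)%N)).
    exact: cvg_mulnl.
  exact: cvg_subnr.
exists 1%N => // -[//|k] _.
have -> : (2 * k.+1 - 1 = k.*2.+1)%N by clear; lia.
have -> : Num.sqrt (tau R) ^+ k.*2.+1 = Num.sqrt (tau R) * tau R ^+ k.
  by rewrite exprS -mul2n exprM expr2 ss.
have /andP[b1 b2] := fib_bounds k.
have t0 : 0 <= tau R ^+ k by rewrite exprn_ge0 //; clear -h1; lra.
rewrite exprS in b2.
have : 0 <= (Num.sqrt (tau R) - 1) * tau R ^+ k.
  by rewrite mulr_ge0 //; clear -s1; lra.
have : 0 <= (2 - Num.sqrt (tau R)) * tau R ^+ k.
  by rewrite mulr_ge0 //; clear -s2; lra.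
have : 0 <= (2 - tau R) * tau R ^+ k by rewrite mulr_ge0 //; clear -h2; lra.
by clear -b1 b2 t0 => H1 H2 H3; apply/andP; split; lra.
Qed.

End RootGrowth.

(** * Cycles and words *)

Lemma card_set_uniq_seq (T : eqType) (s : seq T) :
  uniq s -> [set` s] #= `I_(size s).
Proof.
case: s => [_|x0 s'].
  suff -> : [set` [::] : seq T] = set0 by rewrite II0; exact: card_eq00.
  by apply/seteqP; split.
move: (x0 :: s') => s us.
have -> : [set` s] = nth x0 s @` `I_(size s).
  apply/seteqP; split=> [y /= ys|_ [i /= ilt <-]]; last exact: mem_nth.
  by exists (index y s); [rewrite /= index_mem|rewrite nth_index].
apply: inj_card_eq => i j; rewrite !inE /= => il jl.
by move/eqP; rewrite nth_uniq // => /eqP.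
Qed.

Section Cycles.
Variables (T : eqType) (N : network T).

Lemma mem_cycle_edges (c : seq T) y z :
  cycle_edges c (y, z) <-> y \in c /\ z = next c y.
Proof.
split=> [[x xc [<- <-]]//|[yc ->]]; by exists y.
Qed.

Lemma next_notin (c : seq T) y : y \notin c -> next c y = y.
Proof. by move=> yc; rewrite next_nth (negbTE yc). Qed.

Lemma cycle_edges_mem (c c' : seq T) :
  cycle_edges c = cycle_edges c' -> c =i c'.
Proof.
have sub (s s' : seq T) : cycle_edges s = cycle_edges s' -> {subset s <= s'}.
  move=> e y ys; have : cycle_edges s (y, next s y) by apply/mem_cycle_edges.
  by rewrite e => /mem_cycle_edges[].
by move=> e y; apply/idP/idP; apply: sub.
Qed.

Lemma cycle_edges_next (c c' : seq T) :
  cycle_edges c = cycle_edges c' -> next c = next c'.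
Proof.
move=> e; apply: funext => y; have m := cycle_edges_mem e.
have [yc|yc] := boolP (y \in c); last by rewrite !next_notin // -m.
have : cycle_edges c (y, next c y) by apply/mem_cycle_edges.
by rewrite e => /mem_cycle_edges[_ ->].
Qed.

(** The edge set determines [next], and both lists arise by iterating it from [x]. *)
Lemma cycle_edges_inj x (s s' : seq T) : uniq (x :: s) -> uniq (x :: s') ->
  size s = size s' -> cycle_edges (x :: s) = cycle_edges (x :: s') -> s = s'.
Proof.
move=> us us' ss /cycle_edges_next en.
have tr r : uniq (x :: r) ->
    rcons r x = traject (next (x :: r)) (next (x :: r) x) (size r).+1.
  by move=> /cycle_next /fpathE; rewrite size_rcons.
have : rcons s x = rcons s' x by rewrite (tr s) // (tr s') // en ss.
by move/rcons_inj => [].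
Qed.

Lemma cycle_edges_rot n (c : seq T) :
  uniq c -> cycle_edges (rot n c) = cycle_edges c.
Proof.
move=> uc; apply/seteqP; split=> -[y z] /mem_cycle_edges h;
  by apply/mem_cycle_edges; move: h; rewrite mem_rot next_rot.
Qed.

Lemma min_cycle_rot n c : min_cycle N c -> min_cycle N (rot n c).
Proof.
move=> [c0 cV uc cc]; split; rewrite ?rot_uniq ?rot_cycle //.
  by rewrite -size_eq0 size_rot size_eq0.
by move=> y; rewrite mem_rot; exact: cV.
Qed.

Lemma min_cycle_rot_to c x : min_cycle N c -> x \in c ->
  exists s, [/\ min_cycle N (x :: s), cycle_edges (x :: s) = cycle_edges c,
                size (x :: s) = size c & x :: s =i c].
Proof.
move=> mc xc; have [i s e] := rot_to xc; exists s; rewrite -e size_rot.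
have [_ _ uc _] := mc; split=> //.
- exact: min_cycle_rot.
- exact: cycle_edges_rot.
- exact: mem_rot.
Qed.

End Cycles.

Section Words.
Variable R : realType.
Implicit Types (x y z : R) (u v w : seq bool).
Local Notation step := (fun (x : R) (i : bool) => g i x).
Local Notation endpoint := (foldl step).

Lemma admissible_cat u v x :
  admissible (u ++ v) x = admissible u x && admissible v (endpoint x u).
Proof. by elim: u x => //= i u IH x; rewrite IH andbA. Qed.

Lemma generationP q x y : generation q x y <->
  exists w, [/\ size w = q, admissible w x & endpoint x w = y].
Proof.
elim: q y => [|q IH] y.
  split=> [->|[w [/size0nil -> _ <-]]//]; by exists [::].
split=> [[y' /IH[w [sw aw ew]] [i di ->]]|[w]].
  exists (rcons w i).
  by rewrite size_rcons sw -cats1 admissible_cat foldl_cat aw ew /= di.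
case/lastP: w => [[]//|w i]; rewrite size_rcons -cats1 admissible_cat foldl_cat.
move=> /= [[sw] /andP[aw /andP[di _]] <-]; exists (endpoint x w).
  by apply/IH; exists w.
by exists i.
Qed.

Lemma generationD m n x y z :
  generation m x y -> generation n y z -> generation (m + n) x z.
Proof.
move=> /generationP[u [su au eu]] /generationP[v [sv av ev]].
apply/generationP; exists (u ++ v).
by rewrite size_cat su sv admissible_cat foldl_cat au eu.
Qed.

Lemma generation_itv q x y : 0 <= x <= 1 -> generation q x y -> 0 <= y <= 1.
Proof.
elim: q y => [|q IH] y x01; first by move=> ->.
by move=> [y' _ [i di ->]]; exact: gdom_itv.
Qed.

Lemma admissible_exists q x : 0 <= x <= 1 ->
  exists2 w, size w = q & admissible w x.
Proof.
elim: q x => [|q IH] x x01; first by exists [::].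
have [i di] := gdom_total x01; have [w sw aw] := IH _ (gdom_itv di).
by exists (i :: w); rewrite /= ?sw // di.
Qed.

Lemma edgeP x y z : reflect (exists2 i, gdom i y & z = g i y)
  (edge (orbit_network x) y z).
Proof.
apply: (iffP existsP) => [[i /andP[di /eqP ->]]|[i di ->]]; first by exists i.
by exists i; rewrite di eqxx.
Qed.

Lemma orbit_edge x y z : orbit_set x y -> edge (orbit_network x) y z ->
  orbit_set x z.
Proof.
move=> [q _ hq] /edgeP[i di ->].
by exists q.+1 => //; exists y => //; exists i.
Qed.

Lemma path_scanl r x w : admissible w x ->
  path (edge (orbit_network r)) x (scanl step x w).
Proof.
elim: w x => [|i w IH] x; first by [].
rewrite [admissible _ _]/= => /andP[di aw] /=; rewrite IH // andbT.
by apply/(@edgeP r); exists i.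
Qed.

Lemma path_scanlP r x s : path (edge (orbit_network r)) x s ->
  exists w, [/\ size w = size s, admissible w x & s = scanl step x w].
Proof.
elim: s x => [|y s IH] x /=; first by exists [::].
move=> /andP[/(@edgeP r)[i di ->] /IH[w [sw aw ->]]].
by exists (i :: w); rewrite /= size_scanl sw di.
Qed.

Lemma last_scanl x w : last x (scanl step x w) = endpoint x w.
Proof. by elim: w x => //= i w IH x; rewrite IH. Qed.

(** The two maps never agree, so the vertices of a walk determine its letters; cycles can then be
    counted as words. *)
Lemma scanl_step_inj x w w' : scanl step x w = scanl step x w' -> w = w'.
Proof.
elim: w w' x => [|i w IH] [|i' w'] x //= -[ei].
have <- : i = i'.
  have := negbTE (g_neq x); move: ei {IH}.
  by case: i; case: i' => // ->; rewrite eqxx.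
by move/IH ->.
Qed.

End Words.

(** * Points to which every path returns *)

Section ReturnPoint.
Variables (R : realType) (z : R) (p : nat).
Hypothesis z01 : 0 <= z <= 1.
Hypothesis p_gt0 : (0 < p)%N.
Hypothesis gen_p : generation p z = [set z].
Hypothesis gen_lt : forall q, (0 < q < p)%N -> ~ generation q z z.
Local Notation step := (fun (x : R) (i : bool) => g i x).
Local Notation endpoint := (foldl step).
Local Notation N := (orbit_network z).

(** Generation [p] is [z] alone, so the generations repeat with period [p]. *)
Lemma orbit_level y : orbit_set z y -> exists2 q, (q < p)%N & generation q z y.
Proof.
move=> [q _]; elim/ltn_ind: q => q IH.
have [qp|pq] := ltnP q p; first by exists q.
rewrite -(subnK pq) /generation iterD -/(generation p z) gen_p.
by apply: IH; rewrite ltn_subrL p_gt0 (leq_trans p_gt0).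
Qed.

(** Any admissible continuation of this length ends in generation [p], hence at [z]. *)
Lemma word_to_root q y : (q <= p)%N -> generation q z y ->
  exists w, [/\ size w = (p - q)%N, admissible w y & endpoint y w = z].
Proof.
move=> qp hy; have [w sw aw] := admissible_exists (p - q) (generation_itv z01 hy).
exists w; split=> //.
have hw : generation (p - q) y (endpoint y w) by apply/generationP; exists w.
by have := generationD hy hw; rewrite subnKC // gen_p.
Qed.

(** If [q < r], going to [y] in [q] steps and on to [z] in [p - r] steps would be an early
    return. *)
Lemma level_uniq q r y : (q < p)%N -> (r < p)%N ->
  generation q z y -> generation r z y -> q = r.
Proof.
move=> qp rp; wlog qr : q r qp rp / (q < r)%N => [H hq hr|].
  by have [/H->|/H->|//] := ltngtP q r.
move=> hq hr; have [w [sw aw ew]] := word_to_root (ltnW rp) hr.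
have hw : generation (p - r) y z by apply/generationP; exists w.
by case: (gen_lt (q := q + (p - r)) _ (generationD hq hw)); lia.
Qed.

Lemma generation_take w i : (i <= size w)%N -> admissible w z ->
  generation i z (endpoint z (take i w)).
Proof.
move=> iw; rewrite -{1}(cat_take_drop i w) admissible_cat => /andP[aw _].
by apply/generationP; exists (take i w); rewrite size_takel.
Qed.

(** Following the cycle for [p - q] steps from a vertex of level [q] leads into generation [p]. *)
Lemma root_in_min_cycle c : min_cycle N c -> z \in c.
Proof.
move=> [c0 cV uc cc].
have [v vc] : exists v, v \in c.
  by case: c c0 {cV uc cc} => // v c _; exists v; rewrite mem_head.
have walk k : iter k (next c) v \in c /\
    generation k v (iter k (next c) v).
  elim: k => [//|k [kc gk]]; rewrite iterS mem_next; split=> //.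
  have /(@edgeP _ z)[i di ei] := next_cycle cc kc.
  by exists (iter k (next c) v) => //; exists i.
have [q qp hq] := orbit_level (cV _ vc).
have [kc gk] := walk (p - q)%N; have := generationD hq gk.
by rewrite subnKC ?(ltnW qp) // gen_p => <-.
Qed.

(** The vertices met along the word have different levels, so none is repeated. *)
Lemma cycle_of_word w : size w = p -> admissible w z -> exists s,
  [/\ rcons s z = scanl step z w, min_cycle N (z :: s), size (z :: s) = p &
      forall i, (i < p)%N -> nth z (z :: s) i = endpoint z (take i w)].
Proof.
move=> sw aw; have := path_scanl z aw; have := last_scanl z w.
have -> : endpoint z w = z.
  have : generation p z (endpoint z w) by apply/generationP; exists w.
  by rewrite gen_p.
have : size (scanl step z w) = p by rewrite size_scanl.
have : forall i, (i <= size w)%N ->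
    nth z (z :: scanl step z w) i = endpoint z (take i w).
  by move=> i iw; rewrite nth_cons_scanl.
case/lastP: (scanl step z w) => [_ /= p0|s y]; first by move: p_gt0; rewrite -p0.
rewrite size_rcons last_rcons sw => nthE sp yz.
rewrite {}yz in nthE sp *; move=> hp; exists s.
have nthE' i : (i < p)%N -> nth z (z :: s) i = endpoint z (take i w).
  move=> ip; rewrite -nthE ?(ltnW ip) // -rcons_cons nth_rcons /= sp ip.
  by case: ltngtP ip.
have geni i : (i < p)%N -> generation i z (nth z (z :: s) i).
  by move=> ip; rewrite nthE' //; apply: generation_take; rewrite ?sw // ltnW.
split=> //; split=> //.
  move=> y' /(nthP z)[i]; rewrite /= sp => ip <-.
  by exists i => //; exact: geni.
apply/(uniqP z) => i j; rewrite !inE /= sp => ip jp eij.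
by apply: (level_uniq ip jp (geni i ip)); rewrite eij; exact: geni.
Qed.

Lemma word_of_cycle s : min_cycle N (z :: s) -> size (z :: s) = p /\
  exists w, [/\ size w = p, admissible w z & rcons s z = scanl step z w].
Proof.
move=> [_ _ us] /= /(@path_scanlP _ z)[w [sw aw ew]].
suff sp : size (z :: s) = p.
  by split=> //; exists w; rewrite sw size_rcons.
have geni i : (i <= size w)%N -> generation i z (nth z (z :: rcons s z) i).
  by move=> iw; rewrite ew nth_cons_scanl //; exact: generation_take.
rewrite size_rcons in sw.
(* A longer cycle would meet [z] again at position [p]; a shorter one would be an early return. *)
have sp : (size s < p)%N.
  rewrite ltnNge; apply/negP => ps.
  have := geni p; rewrite sw gen_p => /(_ (leqW ps)).
  case: (p) p_gt0 ps => // p' _ ps /=; rewrite nth_rcons ps => e.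
  by move: us => /= /andP[/negP[]]; rewrite -[X in X \in _]e mem_nth.
move: sp; rewrite leq_eqVlt => /orP[/eqP //|sp].
have := geni (size s).+1; rewrite sw leqnn => /(_ isT) /=.
by rewrite nth_rcons ltnn eqxx => /(@gen_lt (size s).+1 sp).
Qed.

Lemma min_cycle_size c : min_cycle N c -> size c = p.
Proof.
move=> mc; have [s [ms _ <- _]] := min_cycle_rot_to mc (root_in_min_cycle mc).
by have [] := word_of_cycle ms.
Qed.

(** A word to [y], the letter [i] and a word back to [z] are concatenated. The last clause, one
    vertex per level, serves the uniqueness of the root. *)
Lemma cycle_through q y i : (q < p)%N -> generation q z y -> gdom i y ->
  exists c, [/\ min_cycle N c, nth z c q = y, cycle_edges c (y, g i y) &
    forall r, (r < p)%N -> generation r z (nth z c r)].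
Proof.
move=> qp hq di; have /generationP[u [su au eu]] := hq.
have hq1 : generation q.+1 z (g i y) by exists y => //; exists i.
have [v [sv av ev]] := word_to_root qp hq1.
have sw : size (u ++ i :: v) = p by rewrite size_cat /= su sv; lia.
have aw : admissible (u ++ i :: v) z by rewrite admissible_cat au eu /= di.
have [s [es ms ss nthE]] := cycle_of_word sw aw.
have ny : nth z (z :: s) q = y by rewrite nthE // -su take_size_cat.
exists (z :: s); split=> //; last first.
  by move=> r rp; rewrite nthE //; apply: generation_take; rewrite ?sw // ltnW.
have [_ _ us _] := ms.
have ys : y \in z :: s by rewrite -ny mem_nth ?ss.
have yi : index y (z :: s) = q by rewrite -ny index_uniq ?ss.
apply/mem_cycle_edges; split=> //; rewrite next_nth ys yi.
have <- : nth z (rcons s z) q = nth z s q.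
  by rewrite nth_rcons; case: ltnP => // h; rewrite nth_default // if_same.
by rewrite es nth_scanl ?sw // -cat1s catA take_size_cat
  ?size_cat ?su ?addn1 // foldl_cat eu.
Qed.

Lemma orbit_cycle_mixture : finite_set (orbit_set z) -> cycle_mixture p N.
Proof.
move=> fin; split=> //; first exact: min_cycle_size.
move=> y y' /orbit_level[q qp hq] _ /(@edgeP _ z)[i di ->].
by have [c [mc _ ec _]] := cycle_through qp hq di; exists c.
Qed.

Lemma root_vertex_return : root_vertex N z.
Proof. by split; [exists 0%N|exact: root_in_min_cycle]. Qed.

Lemma card_min_cycles : min_cycles N #= `I_(num_successors p z).
Proof.
(* The walk ends at [z] again; [belast] drops this repetition. *)
pose cyc (w : p.-tuple bool) := cycle_edges (belast z (scanl step z w)).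
have cycE (w : p.-tuple bool) s : rcons s z = scanl step z w ->
    cyc w = cycle_edges (z :: s).
  by rewrite /cyc => <-; rewrite belast_rcons.
pose A := [pred w : p.-tuple bool | admissible w z].
have -> : min_cycles N = cyc @` [set` enum A].
  apply/seteqP; split=> [_ [c mc <-]|E [w /= ]]; last first.
    rewrite mem_enum inE => aw <-.
    have [s [es ms _ _]] := cycle_of_word (size_tuple w) aw.
    by exists (z :: s) => //; rewrite (cycE _ s).
  have [s [ms <- _ _]] := min_cycle_rot_to mc (root_in_min_cycle mc).
  have [_ [w [/eqP sw aw ew]]] := word_of_cycle ms.
  by exists (Tuple sw); [rewrite /= mem_enum inE|apply: cycE].
rewrite /num_successors cardE.
apply: card_eq_trans (card_set_uniq_seq (enum_uniq A)).
apply: inj_card_eq => w w'; rewrite !inE /= !mem_enum !inE => aw aw'.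
have [s [es [_ _ us _] ss _]] := cycle_of_word (size_tuple w) aw.
have [s' [es' [_ _ us' _] ss' _]] := cycle_of_word (size_tuple w') aw'.
rewrite (cycE _ _ es) (cycE _ _ es') => e.
have {e} e : s = s'.
  by apply: cycle_edges_inj e => //; move: ss ss' => /= [<-] [].
by apply/val_inj/(@scanl_step_inj _ z); rewrite -es -es' e.
Qed.

Lemma num_successors_split m n (x : R) K :
  (forall y, generation m x y -> num_successors n y = K) ->
  num_successors (m + n) x = (num_successors m x * K)%N.
Proof.
elim: m x => [|m IH] x hK.
  by rewrite add0n num_successors0 mul1n; exact: hK.
rewrite addSn !num_successorsS mulnDl -!mulnA.
have step1 i : (gdom i x * num_successors (m + n) (g i x) =
    gdom i x * (num_successors m (g i x) * K))%N.
  have [di|//] := boolP (gdom i x); congr muln.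
  apply: IH => y hy; apply: hK; rewrite -[m.+1]add1n.
  by apply: generationD hy; exists x => //; exists i.
by rewrite !step1.
Qed.

Lemma growth_rate_return :
  growth_rate z ((num_successors p z)%:R `^ p%:R^-1).
Proof.
set m := num_successors p z; set l := _ `^ _.
have m1 : 1 <= m%:R :> R by rewrite ler1n; exact: num_successors_gt0.
have m0 : 0 < m%:R :> R := lt_le_trans ltr01 m1.
have l0 : 0 <= l := powR_ge0 _ _.
have lp : l ^+ p = m%:R.
  by rewrite -powR_mulrn // -powRrM mulVf ?powRr1 ?ler0n // pnatr_eq0 -lt0n.
have l1 : 1 <= l by rewrite -(expr_ge1 p_gt0 l0) lp.
have succE q : num_successors (p + q) z = (m * num_successors q z)%N.
  by apply: num_successors_split => y; rewrite gen_p => ->.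
(* A further [p] steps multiply both the count and [l ^+ q] by [m], so the constants only have to
   fit for [q < p], where the count is between 1 and [2 ^ p] and [l ^+ q] between 1 and [m]. *)
apply: (@cvg_root _ id _ m%:R^-1 (2 ^ p)%N%:R) => //.
- by rewrite invr_gt0.
apply: nearW => q; rewrite ler_pdivrMl //.
elim/ltn_ind: q => q IH; have [qp|pq] := ltnP q p.
  have lq : 1 <= l ^+ q by exact: exprn_ege1.
  apply/andP; split.
    rewrite -lp -[leLHS]mulr1; apply: ler_pM => //.
    - by rewrite exprn_ge0.
    - by rewrite ler_weXn2l // ltnW.
    - by rewrite ler1n; exact: num_successors_gt0.
  rewrite -[leLHS]mulr1; apply: ler_pM => //.
  by rewrite ler_nat (leq_trans (num_successors_le _ _)) // leq_pexp2l // ltnW.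
have /IH/andP[h1 h2] : (q - p < q)%N by lia.
have -> : l ^+ q = m%:R * l ^+ (q - p) by rewrite -lp -exprD subnKC.
rewrite -{2 3}(subnKC pq) succE natrM !ler_pM2l // h1 mulrCA ler_pM2l //.
Qed.

Hypothesis gen_pair : forall q, (0 < q < p)%N ->
  exists a b : R, a != b /\ generation q z = [set a; b].

(** The levels are disjoint, with one point at level 0 and two at each of the other [p - 1]
    levels. *)
Lemma orbit_enum : exists s : seq R,
  [/\ uniq s, size s = (2 * p - 1)%N & orbit_set z = [set` s]].
Proof.
suff [s [us ss es]] : exists s : seq R, [/\ uniq s, size s = (2 * p - 1)%N &
    forall y, y \in s <-> exists2 q, (q < p)%N & generation q z y].
  exists s; split=> //; apply/seteqP; split=> y /=.
    by move=> /orbit_level; rewrite -es.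
  by move/es => [q _ hq]; exists q.
suff H : forall n, (n < p)%N -> exists s : seq R,
    [/\ uniq s, size s = (2 * n.+1 - 1)%N &
    forall y, y \in s <-> exists2 q, (q < n.+1)%N & generation q z y].
  by case: (p) p_gt0 (H p.-1) => // p' _; apply; rewrite /=.
elim=> [_|n IH np].
  exists [:: z]; split=> // y; rewrite inE; split=> [/eqP->|[[|//] _ ->//]].
  by exists 0%N.
have [s [us ss es]] := IH (ltnW np).
have [a [b [ab gab]]] := @gen_pair n.+1 np.
have new y : generation n.+1 z y -> y \notin s.
  move=> hn; apply/negP => /es[q qn hq].
  by have := level_uniq (ltn_trans qn np) np hq hn; lia.
exists [:: a, b & s]; split.
- rewrite /= us inE negb_or ab !new // gab; by [left|right].
- by rewrite /= ss; lia.
move=> y; rewrite !inE; split.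
  move=> /or3P[/eqP->|/eqP->|/es[q qn hq]].
  - by exists n.+1 => //; rewrite gab; left.
  - by exists n.+1 => //; rewrite gab; right.
  - by exists q => //; exact: leqW.
move=> [q]; rewrite ltnS leq_eqVlt => /orP[/eqP->|qn hq].
  by rewrite gab => -[] /= ->; rewrite eqxx ?orbT.
by apply/or3P; apply: Or33; apply/es; exists q.
Qed.

Lemma card_orbit : orbit_set z #= `I_(2 * p - 1)%N.
Proof. by have [s [us <- ->]] := orbit_enum; exact: card_set_uniq_seq. Qed.

(** A second root would have positive level; a cycle through the other point of that level misses
    it. *)
Lemma orbit_prime_cycle_mixture : prime_cycle_mixture p N.
Proof.
have [s [_ _ es]] := orbit_enum.
split; first by apply: orbit_cycle_mixture; rewrite es.
exists z; split; first exact: root_vertex_return.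
move=> r [/orbit_level[q qp hr] rc].
have [q0|q0] := posnP q; first by move: hr; rewrite q0.
have [y ry hy] : exists2 y, r != y & generation q z y.
  have [|a [b [ab gab]]] := @gen_pair q; first by rewrite q0.
  move: hr; rewrite gab => -[] /= ->; [exists b => //; by right|exists a].
    by rewrite eq_sym.
  by left.
have [i di] := gdom_total (generation_itv z01 hy).
have [c [mc yc _ gc]] := cycle_through qp hy di.
have /(nthP z)[j jc ej] := rc _ mc; rewrite (min_cycle_size mc) in jc.
have jq : j = q by apply: (level_uniq jc qp _ hr); rewrite -ej; exact: gc.
by move: ry; rewrite -ej jq yc eqxx.
Qed.

End ReturnPoint.

(** * The orbits with odd period *)

Section Itinerary.
Variable R : realType.
Local Notation t := (tau R).

(** The powers alternate in sign and shrink, so the first two are the extremes. *)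
Lemma expr_neg_bounds n : - (2 - t) <= (t - 2) ^+ n.+1 <= (2 - t) * (2 - t).
Proof.
have /andP[h1 h2] := tau_bounds R.
elim: n => [|n /andP[]]; first by rewrite expr1; apply/andP; split; nra.
rewrite [_ ^+ n.+2]exprS; move: (_ ^+ _) => x x1 x2.
have r0 : 0 <= 2 - t by lra.
have := ler_wpM2l r0 x1; have := ler_wpM2l r0 x2.
have : (2 - t) * ((2 - t) * (2 - t)) <= 2 - t by nra.
by clear -h1 => *; apply/andP; split; lra.
Qed.

(* For even j the distance e satisfies t ^ 3 (a + e) + 1 - t =
   a + e (t - 2) ^ j, for odd j it satisfies t (1 - t ^ 2 (a + e)) + 1 - t =
   a + e (t - 2) ^ j, where a = (7 - 4 t) / 5 is the fixed point of
   x |-> 2 - t - t ^ 2 x. *)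
Lemma exists_deviation j : let a := (7 - 4 * t) / 5 in
  exists2 e, 5 / 100 <= e <= 13 / 100 &
    a + e * (t - 2) ^+ j =
    t * (if odd j then 1 - (t + 1) * (a + e) else (t + 1) * (a + e)) + 1 - t.
Proof.
have /andP[h1 h2] := tau_bounds R; have h3 := tau_sqr R.
have h4 : t * t * t = 2 * t + 1 by rewrite h3 mulrDl h3; lra.
have pow_le1 : (2 - t) ^+ j <= 1 by apply: exprn_ile1; lra.
have pow_ge0 : 0 <= (2 - t) ^+ j by apply: exprn_ge0; lra.
have -> : (t - 2) ^+ j = (-1) ^+ odd j * (2 - t) ^+ j.
  by rewrite signr_odd -exprMn; congr (_ ^+ _); ring.
(* The equation is linear in [e], with coefficient [2 * t + 1 - x] for [x = (2 - t) ^+ j]. For odd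
   [j] the bound [x <= 2 - t] keeps [e] below 13 / 100. *)
have [oj|ej] := boolP (odd j).
  have pow_le : (2 - t) ^+ j <= 2 - t.
    case: j oj pow_le1 pow_ge0 => // j _ _ _; rewrite exprS ler_piMr; first by [].
      by lra.
    by apply: exprn_ile1; lra.
  move: (_ ^+ j) pow_le1 pow_ge0 pow_le => x x1 x0 x2.
  have D0 : 0 < 2 * t + 1 - x by lra.
  exists ((2 * t - 1) / 5 / (2 * t + 1 - x)).
    by rewrite ler_pdivlMr // ler_pdivrMr //; apply/andP; split; lra.
  set e := _ / (2 * t + 1 - x).
  have : e * (2 * t + 1 - x) = (2 * t - 1) / 5 by rewrite mulfVK // gt_eqF.
  rewrite expr1 => he.
  have : t * (t * e) = (t + 1) * e by rewrite mulrA h3.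
  lra.
move: (_ ^+ j) pow_le1 pow_ge0 => x x1 x0.
have D0 : 0 < 2 * t + 1 - x by lra.
exists ((3 - t) / 5 / (2 * t + 1 - x)).
  by rewrite ler_pdivlMr // ler_pdivrMr //; apply/andP; split; lra.
set e := _ / (2 * t + 1 - x).
have : e * (2 * t + 1 - x) = (3 - t) / 5 by rewrite mulfVK // gt_eqF.
rewrite expr0 => he.
have : t * (t * e) = (t + 1) * e by rewrite mulrA h3.
lra.
Qed.

(* The generations 2 i + 1 and 2 i + 2 of z will be {y i, y i + 1 / t} and
   {t (y i), t (y i) + 1 / t ^ 2}.  The parity of i decides which point of the
   latter pair branches; for i = j none does and both lead back to z. *)
Definition itinerary (j : nat) (z : R) (y : nat -> R) : Prop :=
  [/\ y 0%N = t * z + 1 - t, z = t * (t * y j), 5 - 3 * t < y j < 2 * t - 3 &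
      forall i, (i < j)%N ->
        if odd i then 2 * t - 3 <= y i < 2 - t /\ y i.+1 = t * (t * y i) + 1 - t
        else 0 < y i <= 5 - 3 * t /\ y i.+1 = t * (t * y i)].

Lemma exists_itinerary j : exists z y, itinerary j z y.
Proof.
have /andP[h1 h2] := tau_bounds R; have h3 := tau_sqr R.
have h4 : t * t * t = 2 * t + 1 by rewrite h3 mulrDl h3; lra.
have [e /andP[e1 e2] he] := exists_deviation j; rewrite /= in he.
(* [yt] follows x |-> 2 - t - t ^ 2 x, which multiplies deviations from [a] by - t ^ 2, the inverse
   of [t - 2]. Reflecting every second term by x |-> 2 - t - x, the effect of x |-> 1 - x on pairs
   at distance 1 / t, yields the two alternating replacements. *)
pose a := (7 - 4 * t) / 5; pose yt i := a + e * (t - 2) ^+ (j - i).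
pose y i := if odd i then 2 - t - yt i else yt i.
have yS i : (i < j)%N -> yt i.+1 = 2 - t - t * (t * yt i).
  move=> ij; rewrite /yt -[X in (j - X)%N]addn1 subnDA subn1.
  have : (0 < j - i)%N by rewrite subn_gt0.
  case: (j - i)%N => // n _ /=; rewrite exprS; move: (_ ^+ n) => x.
  have : t * t * (e * x) = (t + 1) * (e * x) by rewrite h3.
  have : t * t * t * (e * x) = (2 * t + 1) * (e * x) by rewrite h4.
  by rewrite /a => ? ?; lra.
have yj : yt j = a + e by rewrite /yt subnn mulr1.
have yb i : (i < j)%N -> 0 < yt i <= 5 - 3 * t.
  move=> ij; rewrite /yt; have : (0 < j - i)%N by rewrite subn_gt0.
  case: (j - i)%N => // n _; have /andP[] := expr_neg_bounds n.
  have e0 : 0 <= e by lra.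
  move=> /(ler_wpM2l e0) x1 /(ler_wpM2l e0) x2.
  by rewrite /a; clear -x1 x2 e1 e2 h1 h2; apply/andP; split; nra.
exists (t * (t * y j)), y; split=> //.
- have tt c : t * (t * c) = (t + 1) * c by rewrite mulrA h3.
  rewrite {1}/y /= /yt subn0 he tt /y yj -/a; clearbody a.
  by case: (odd j); lra.
(* The bounds on [e] put [y j] into the interval where the pair merges. *)
- by rewrite /y /= yj /a; case: (odd j); lra.
move=> i ij; have /andP[] := yb i ij; have := yS i ij; rewrite /y /=.
by clear -h4 h3; case: (odd i) => /= -> y1 y2; split; lra.
Qed.

End Itinerary.

Lemma split_level (q j : nat) : (0 < q < 2 * j + 3)%N ->
  exists i, (i <= j)%N /\ (q = (2 * i).+1 \/ q = (2 * i).+2).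
Proof. by move=> qj; exists (q.-1)./2; lia. Qed.

(** * Successor sets of points and of pairs at distance 1 / t or 1 / t ^ 2 *)

Section SuccessorSets.
Variable R : realType.
Local Notation t := (tau R).

Lemma succsU (A B : set R) : succs (A `|` B) = succs A `|` succs B.
Proof.
apply/seteqP; split=> z.
  by move=> [y [Ay|By] h]; [left|right]; exists y.
by move=> [|] [y Ay h]; exists y => //; [left|right].
Qed.

Lemma succs1E (x : R) :
  succs [set x] = [set z | exists2 i, gdom i x & z = g i x].
Proof. by apply/seteqP; split=> z => [[y ->]|h] //; exists x. Qed.

Lemma succs_low (x : R) : 0 <= x < 2 - t -> succs [set x] = [set t * x].
Proof.
move=> hx; have /andP[h1 h2] := tau_bounds R; rewrite succs1E.
apply/seteqP; split=> z /= [].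
  by case=> // + _; rewrite gdomE; lra.
by exists false => //; rewrite gdomE; lra.
Qed.

Lemma succs_high (x : R) :
  t - 1 < x <= 1 -> succs [set x] = [set t * x + 1 - t].
Proof.
move=> hx; have /andP[h1 h2] := tau_bounds R; rewrite succs1E.
apply/seteqP; split=> z /= [].
  by case=> // + _; rewrite gdomE; lra.
by exists true => //; rewrite gdomE; lra.
Qed.

Lemma succs_mid (x : R) : 2 - t <= x <= t - 1 ->
  succs [set x] = [set t * x + 1 - t; t * x].
Proof.
move=> hx; have /andP[h1 h2] := tau_bounds R; rewrite succs1E.
apply/seteqP; split=> z /= [].
- by case=> _ ->; [left|right].
- by move=> ->; exists true => //; rewrite gdomE; lra.
- by move=> ->; exists false => //; rewrite gdomE; lra.
Qed.

Lemma succs_far_pair (y : R) : 0 < y < 2 - t ->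
  succs [set y; y + t - 1] = [set t * y; t * y + 2 - t].
Proof.
move=> /andP[y0 y1]; have /andP[h1 h2] := tau_bounds R; have h3 := tau_sqr R.
rewrite succsU (@succs_low y) ?(@succs_high (y + t - 1)); [|lra..].
by congr (_ `|` [set _]); lra.
Qed.

Lemma succs_near_pair_low (u : R) : 0 <= u <= 2 * t - 3 ->
  succs [set u; u + 2 - t] = [set t * u; t * u + t - 1].
Proof.
move=> /andP[u0 u1]; have /andP[h1 h2] := tau_bounds R; have h3 := tau_sqr R.
rewrite succsU (@succs_low u) ?(@succs_mid (u + 2 - t)); [|lra..].
have -> : t * (u + 2 - t) + 1 - t = t * u by lra.
have -> : t * (u + 2 - t) = t * u + t - 1 by lra.
by rewrite setUA setUid.
Qed.

Lemma succs_near_pair_high (u : R) : 2 - t <= u <= t - 1 ->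
  succs [set u; u + 2 - t] =
  [set t * u + 1 - t; t * u + 1 - t + t - 1].
Proof.
move=> /andP[u0 u1]; have /andP[h1 h2] := tau_bounds R; have h3 := tau_sqr R.
rewrite succsU (@succs_mid u) ?(@succs_high (u + 2 - t)); [|lra..].
have -> : t * (u + 2 - t) + 1 - t = t * u by lra.
have -> : t * u + 1 - t + t - 1 = t * u by lra.
by rewrite -setUA setUid.
Qed.

Lemma succs_near_pair_mid (u : R) : 2 * t - 3 < u < 2 - t ->
  succs [set u; u + 2 - t] = [set t * u].
Proof.
move=> /andP[u0 u1]; have /andP[h1 h2] := tau_bounds R; have h3 := tau_sqr R.
rewrite succsU (@succs_low u) ?(@succs_high (u + 2 - t)); [|lra..].
have -> : t * (u + 2 - t) + 1 - t = t * u by lra.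
by rewrite setUid.
Qed.

End SuccessorSets.

#[local] Arguments fib : simpl never.

(** * Generations, returns and multiplicities along an itinerary *)

Section ItineraryOrbit.
Variables (R : realType) (j : nat) (z : R) (y : nat -> R).
Local Notation t := (tau R).
Local Notation f := (@num_successors R).
Hypothesis it : itinerary j z y.

Lemma itinerary_y_bounds i : (i <= j)%N -> 0 < y i < 2 - t.
Proof.
have /andP[h1 h2] := tau_bounds R; case: it => _ _ yj hy.
rewrite leq_eqVlt => /orP[/eqP->|/hy]; first by lra.
by case: (odd i) => -[] /andP[? ?] _; lra.
Qed.

Lemma itinerary_z_bounds : 2 - t < z < t - 1.
Proof.
have /andP[h1 h2] := tau_bounds R; have h3 := tau_sqr R.
case: it => _ -> /andP[yj1 yj2] _.
have -> : t * (t * y j) = (t + 1) * y j by rewrite mulrA h3.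
have t10 : 0 < t + 1 by lra.
move: yj1 yj2; rewrite -(ltr_pM2l t10 (5 - 3 * t)) -(ltr_pM2l t10 (y j)).
by move=> ? ?; apply/andP; split; lra.
Qed.

Lemma itinerary_generation i : (i <= j)%N ->
  generation (2 * i).+1 z = [set y i; y i + t - 1] /\
  generation (2 * i).+2 z = [set t * y i; t * y i + 2 - t].
Proof.
have /andP[h1 h2] := tau_bounds R; have h3 := tau_sqr R.
have t0 : 0 < t by lra.
have [y0 _ _ hy] := it.
have far q i' : (i' <= j)%N -> generation q z = [set y i'; y i' + t - 1] ->
    generation q.+1 z = [set t * y i'; t * y i' + 2 - t].
  move=> ij e; rewrite /generation iterS -/(generation q z) e.
  exact/succs_far_pair/itinerary_y_bounds.
elim: i => [|i IH] ij.
  have e : generation (2 * 0).+1 z = [set y 0%N; y 0%N + t - 1].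
    rewrite /generation muln0 /= succs_mid; last first.
      by have /andP[? ?] := itinerary_z_bounds; lra.
    by rewrite y0; congr (_ `|` [set _]); lra.
  by split=> //; exact: far e.
have [_ e] := IH (ltnW ij).
suff e' : generation (2 * i.+1).+1 z = [set y i.+1; y i.+1 + t - 1].
  by split=> //; exact: far e'.
rewrite mulnS /generation iterS -/(generation (2 * i).+2 z) e.
have := hy i ij; case: (odd i) => -[/andP[yi1 yi2] ->].
  move: yi1 yi2; rewrite -(ler_pM2l t0 _ (y i)) -(ltr_pM2l t0 (y i)) => yi1 yi2.
  by rewrite succs_near_pair_high //; lra.
move: yi1 yi2; rewrite -(ltr_pM2l t0 _ (y i)) -(ler_pM2l t0 (y i)) => yi1 yi2.
by rewrite succs_near_pair_low //; lra.
Qed.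

Lemma itinerary_return : generation (2 * j + 3) z = [set z].
Proof.
have /andP[h1 h2] := tau_bounds R; have h3 := tau_sqr R.
have t0 : 0 < t by lra.
have [_ zE /andP[yj1 yj2] _] := it.
have [_ e] := itinerary_generation (leqnn j).
rewrite addn3 /generation iterS -/(generation (2 * j).+2 z) e.
move: yj1 yj2; rewrite -(ltr_pM2l t0 _ (y j)) -(ltr_pM2l t0 (y j)) => yj1 yj2.
by rewrite succs_near_pair_mid -?zE //; lra.
Qed.

(* If some y i with 0 < i <= j were equal to y 0 then, the y's being iterates
   of a map, y j would be equal to y (j - i), which does not lie in the middle
   interval. *)
Lemma itinerary_y_neq i : (0 < i <= j)%N -> y i <> y 0%N.
Proof.
have /andP[h1 h2] := tau_bounds R; have [_ _ /andP[yj1 yj2] hy] := it.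
pose T (x : R) := if x <= 5 - 3 * t then t * (t * x) else t * (t * x) + 1 - t.
have yS k : (k < j)%N -> y k.+1 = T (y k).
  move=> kj; rewrite /T; have := hy k kj.
  case: (odd k) => -[/andP[yk1 yk2] ->]; last by rewrite yk2.
  by have -> : (y k <= 5 - 3 * t) = false by apply/negP; lra.
have yT k n : (n + k <= j)%N -> y (n + k)%N = iter n T (y k).
  by elim: n => // n IH nk; rewrite addSn yS // IH // ltnW.
move=> /andP[i0 ij] e.
have e' : y j = y (j - i)%N.
  have := @yT i (j - i)%N; rewrite subnK // e => -> //.
  by have := @yT 0%N (j - i)%N; rewrite addn0 => -> //; exact: leq_subr.
have /hy : (j - i < j)%N by clear -i0 ij; lia.
by rewrite -e'; case: (odd _) => -[/andP[? ?] _]; lra.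
Qed.

Lemma itinerary_no_early_return q :
  (0 < q < 2 * j + 3)%N -> ~ generation q z z.
Proof.
have /andP[h1 h2] := tau_bounds R; have h3 := tau_sqr R.
have t0 : 0 < t by lra.
have /andP[z1 z2] := itinerary_z_bounds.
move=> qp hz.
have [i [ij eq]] := split_level qp.
have /andP[yi1 yi2] := itinerary_y_bounds ij.
have [e1 e2] := itinerary_generation ij.
(* In odd generations the two points lie on either side of the branching interval, which contains
   [z]. *)
case: eq => eq; first by move: hz; rewrite eq e1 => -[] /= ?; lra.
(* The pair about to merge also encloses this interval. *)
move: (ij); rewrite leq_eqVlt => /orP[/eqP eij|ij'].
  have [_ _ /andP[yj1 yj2] _] := it; move: yj1 yj2.
  rewrite -(ltr_pM2l t0 _ (y j)) -(ltr_pM2l t0 (y j)) => yj1 yj2.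
  by move: hz; rewrite eq e2 eij => -[] /= ?; lra.
(* Otherwise a return to [z] would bring [y 0] into generation [2 i + 3], as [y i.+1] or as its
   partner above the branching interval. *)
have [g1 _] := itinerary_generation (leq0n j).
have y0z : generation 1 z (y 0%N) by rewrite g1; left.
have := generationD hz y0z; have [g2 _] := itinerary_generation ij'.
have -> : (q + 1 = (2 * i.+1).+1)%N by rewrite eq mulnS addn1.
rewrite g2.
have /andP[y01 y02] := itinerary_y_bounds (leq0n j).
have /andP[yi3 yi4] := itinerary_y_bounds ij'.
by case=> /= e; [case: (@itinerary_y_neq i.+1)|lra].
Qed.

Lemma itinerary_pairs q : (0 < q < 2 * j + 3)%N ->
  exists a b : R, a != b /\ generation q z = [set a; b].
Proof.
have /andP[h1 h2] := tau_bounds R.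
move=> qp.
have [i [ij eq]] := split_level qp.
have [e1 e2] := itinerary_generation ij.
case: eq => ->; [exists (y i), (y i + t - 1)|exists (t * y i), (t * y i + 2 - t)].
  by split=> //; apply/eqP; lra.
by split=> //; apply/eqP; lra.
Qed.

Lemma itinerary_num_successors : f (2 * j + 3) z = fib j.+3.
Proof.
have /andP[h1 h2] := tau_bounds R; have h3 := tau_sqr R.
have t0 : 0 < t by lra.
have [y0 _ yj hy] := it.
have farE n i : (i <= j)%N -> f n.+1 (y i) = f n (t * y i) /\
    f n.+1 (y i + t - 1) = f n (t * y i + 2 - t).
  move=> /itinerary_y_bounds/andP[yi1 yi2].
  rewrite (@num_successors_low _ _ (y i)); last by lra.
  rewrite (@num_successors_high _ _ (y i + t - 1)); last by lra.
  by split=> //; congr (f n _); lra.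
have nearE n i : (i <= j)%N ->
    f n.+1 (t * y i) = (f n (t * (t * y i))%R +
      (2 - t <= t * y i)%R * f n (t * (t * y i) + 1 - t)%R)%N /\
    f n.+1 (t * y i + 2 - t) = (f n (t * (t * y i))%R +
      (t * y i <= 2 * t - 3)%R * f n (t * (t * y i) + t - 1)%R)%N.
  move=> /itinerary_y_bounds/andP[yi1 yi2]; apply: num_successors_near_pair.
  by move: yi1 yi2; rewrite -(ltr_pM2l t0 _ (y i)) -(ltr_pM2l t0 (y i)) => ? ?; lra.
(* [c i] holds the multiplicities of [y i] and [y i + t - 1] in generation [2 i + 1]; the parity
   decides which of them is replaced by the sum. The final merging adds both. *)
pose c i := if odd i then (fib i.+2, fib i.+1) else (fib i.+1, fib i.+2).
have main i : (i <= j)%N -> f (2 * j + 3) z =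
    ((c i).1 * f (2 * (j - i)).+2 (y i) +
     (c i).2 * f (2 * (j - i)).+2 (y i + t - 1)%R)%N.
  elim: i => [_|i IH ij].
    rewrite !mul1n subn0 addn3 (@num_successors_mid _ _ z); last first.
      by have /andP[? ?] := itinerary_z_bounds; lra.
    by rewrite y0; congr (_ + f _ _)%N; lra.
  rewrite IH ?(ltnW ij) //; have -> : (2 * (j - i) = (2 * (j - i.+1)).+2)%N.
    by clear -ij; lia.
  move: (2 * (j - i.+1)).+2 => n.
  have [-> ->] := farE n.+1 i (ltnW ij); have [-> ->] := nearE n i (ltnW ij).
  have fibE : fib i.+3 = (fib i.+2 + fib i.+1)%N by [].
  rewrite /c /=; have := hy i ij; case: (odd i) => -[/andP[yi1 yi2] ->] /=.
    have -> : (2 - t <= t * y i) = true.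
      by move: yi1; rewrite -(ler_pM2l t0 _ (y i)); lra.
    have -> : (t * y i <= 2 * t - 3) = false.
      by move: yi1; rewrite -(ler_pM2l t0 _ (y i)) => ?; apply/negP; lra.
    have -> : t * (t * y i) + 1 - t + t - 1 = t * (t * y i) by lra.
    by rewrite !fibE !mul0n !mul1n; ring.
  have -> : (2 - t <= t * y i) = false.
    by move: yi2; rewrite -(ler_pM2l t0 (y i)) => ?; apply/negP; lra.
  have -> : (t * y i <= 2 * t - 3) = true.
    by move: yi2; rewrite -(ler_pM2l t0 (y i)); lra.
  by rewrite !fibE !mul0n !mul1n; ring.
have := main j (leqnn j); rewrite subnn muln0 => ->.
have [-> ->] := farE 1%N j (leqnn j); have [-> ->] := nearE 0%N j (leqnn j).
move: yj => /andP[yj1 yj2]; move: yj1 yj2.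
rewrite -(ltr_pM2l t0 _ (y j)) -(ltr_pM2l t0 (y j)) => yj1 yj2.
have -> : (2 - t <= t * y j) = false by apply/negP; lra.
have -> : (t * y j <= 2 * t - 3) = false by apply/negP; lra.
have -> : fib j.+3 = (fib j.+2 + fib j.+1)%N by [].
by rewrite !num_successors0 /c; case: (odd j) => /=; ring.
Qed.

End ItineraryOrbit.

(** * The orbit of 1 / sqrt 5 *)

(* The orbit of 1 / sqrt 5 is invariant under x |-> 1 - x; the last component
   of an index tells whether the point is reflected. *)
Definition orbit_index : Type := (bool * bool * bool)%type.

Definition successors_of (k : orbit_index) : seq orbit_index :=
  let: (p, q, r) := k in
  match p, q with
  | false, false => [:: (false, true, r); (true, false, r)]
  | false, true => [:: (false, false, ~~ r)]
  | true, false => [:: (true, true, r)]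
  | true, true => [:: (false, true, ~~ r)]
  end.

Definition index_edge : rel (bool * bool * bool) :=
  fun k l => l \in successors_of k.

Definition short_loop (r : bool) : seq orbit_index :=
  [:: (false, false, r); (true, false, r); (true, true, r);
      (false, true, ~~ r)].

Definition long_loop (r : bool) : seq orbit_index :=
  [:: (false, false, r); (false, true, r); (false, false, ~~ r);
      (false, true, ~~ r)].

(** Only the indices [(false, false, _)] branch, so few walks arise; those that do not close to one
    of the loops repeat a vertex. *)
Lemma index_cycle_from r (s : seq orbit_index) :
  let x := (false, false, r) in
  path index_edge x (rcons s x) -> uniq (x :: s) ->
  x :: s = short_loop r \/ x :: s = long_loop r.
Proof.
rewrite /= /index_edge.
case: s => [|y1 s]; first by case: r.
move=> /= /andP[]; rewrite !inE => /orP[]/eqP->.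
  case: s => [|y2 s]; first by case: r.
  move=> /= /andP[]; rewrite !inE => /eqP->.
  case: s => [|y3 s]; first by case: r.
  move=> /= /andP[]; rewrite !inE => /orP[]/eqP->.
    case: s => [|y4 s]; first by right.
    by move=> /= /andP[]; rewrite !inE => /eqP-> _; case: r.
  case: s => [|y4 s]; first by case: r.
  move=> /= /andP[]; rewrite !inE => /eqP->.
  case: s => [|y5 s]; first by case: r.
  move=> /= /andP[]; rewrite !inE => /eqP-> _.
  by case: r; rewrite /= !andbF.
case: s => [|y2 s]; first by case: r.
move=> /= /andP[]; rewrite !inE => /eqP->.
case: s => [|y3 s]; first by case: r.
move=> /= /andP[]; rewrite !inE => /eqP->.
case: s => [|y4 s]; first by left.
by move=> /= /andP[]; rewrite !inE => /eqP-> _; case: r.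
Qed.

Lemma index_cycle_classes (c : seq orbit_index) :
  c != [::] -> uniq c -> cycle index_edge c ->
  exists n, rot n c \in [:: short_loop false; short_loop true; long_loop false].
Proof.
move=> c0 uc cc.
have nx k : k \in c -> exists2 l, l \in c & l \in successors_of k.
  by move=> kc; exists (next c k); [rewrite mem_next|exact: next_cycle cc kc].
(* From every other index the walk is forced to a branching one. *)
have [r rc] : exists r, (false, false, r) \in c.
  have Bc r : (false, true, r) \in c -> exists r, (false, false, r) \in c.
    by move=> /nx[l lc]; rewrite inE => /eqP el; exists (~~ r); rewrite -el.
  have Dc r : (true, true, r) \in c -> exists r, (false, false, r) \in c.
    move=> /nx[l lc]; rewrite inE => /eqP el; apply: (Bc (~~ r)).
    by rewrite -el.
  have [[[p q] r] kc] : exists k, k \in c.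
    by case: (c) c0 => // k s _; exists k; rewrite mem_head.
  case: p q kc => -[] kc; [exact: Dc kc| |exact: Bc kc|by exists r].
  have [l lc] := nx _ kc; rewrite inE => /eqP el; apply: (Dc r).
  by rewrite -el.
have [n s e] := rot_to rc.
have ps : path index_edge (false, false, r) (rcons s (false, false, r)).
  by rewrite -[path _ _ _]/(cycle index_edge ((false, false, r) :: s)) -e rot_cycle.
have us : uniq ((false, false, r) :: s) by rewrite -e rot_uniq.
have [es|es] := index_cycle_from ps us.
  by exists n; rewrite e es; case: (r).
(* [long_loop true] is [long_loop false] started two vertices later. *)
case: r e es {ps us rc} => e es; last by exists n; rewrite e es.
exists (rot_add c n 2); rewrite -rot_rot_add e es.
by [].
Qed.

Section GoldenMean.
Variable R : realType.
Local Notation t := (tau R).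
Local Notation s := (Num.sqrt (tau R)).
Local Notation f := (@num_successors R).

Definition base_point (p q : bool) : R :=
  match p, q with
  | false, false => (2 * t - 1) / 5
  | false, true => (t + 2) / 5
  | true, false => (7 - 4 * t) / 5
  | true, true => (3 * t - 4) / 5
  end.

Definition point (k : orbit_index) : R :=
  let: (p, q, r) := k in if r then 1 - base_point p q else base_point p q.

Lemma point_inj : injective point.
Proof.
have /andP[h1 h2] := tau_bounds R.
pose k0 : orbit_index := (true, false, false).
(* All eight indices, in increasing order of their points. *)
pose L : seq orbit_index := [:: k0; (true, true, false); (false, true, true);
  (false, false, false); (false, false, true); (false, true, false);
  (true, true, true); (true, false, true)].
have LT k : k \in L by case: k => [[[] []] []].
have uL : uniq (map point L).
  apply: (sorted_uniq lt_trans ltxx).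
  by rewrite /= andbT; do ![apply/andP; split]; lra.
move=> k l e.
have lt_i m : (index m L < size L)%N by rewrite index_mem.
have := @nth_uniq _ (point k0) (map point L) (index k L) (index l L).
rewrite size_map !(nth_map k0) // !nth_index // e eqxx.
move=> /(_ (lt_i k) (lt_i l) uL)/esym/eqP ei.
by rewrite -(nth_index k0 (LT k)) ei nth_index.
Qed.

Lemma num_successors_point n k :
  f n.+1 (point k) = (\sum_(l <- successors_of k) f n (point l))%N.
Proof.
have /andP[h1 h2] := tau_bounds R; have h3 := tau_sqr R.
case: k => [[[] []] []]; rewrite ?big_cons big_nil addn0 /=.
- rewrite (@num_successors_high _ _ (1 - _)); last by lra.
  by congr (f n _); lra.
- rewrite (@num_successors_low _ _ (_ / 5)); last by lra.
  by congr (f n _); lra.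
- rewrite (@num_successors_high _ _ (1 - _)); last by lra.
  by congr (f n _); lra.
- rewrite (@num_successors_low _ _ (_ / 5)); last by lra.
  by congr (f n _); lra.
- rewrite (@num_successors_low _ _ (1 - _)); last by lra.
  by congr (f n _); lra.
- rewrite (@num_successors_high _ _ (_ / 5)); last by lra.
  by congr (f n _); lra.
- rewrite (@num_successors_mid _ _ (1 - _)); last by lra.
  by congr (f n _ + f n _)%N; lra.
- rewrite (@num_successors_mid _ _ (_ / 5)) 1?addnC; last by lra.
  by congr (f n _ + f n _)%N; lra.
Qed.

Lemma succs_point k :
  succs [set point k] = [set y | y \in map point (successors_of k)].
Proof.
have /andP[h1 h2] := tau_bounds R; have h3 := tau_sqr R.
have set1E (a b : R) : a = b -> [set a] = [set y | y \in [:: b]].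
  by move=> ->; apply/seteqP; split=> y /=; rewrite inE => /eqP.
have set2E (a b c d : R) :
    a = c -> b = d -> [set a; b] = [set y | y \in [:: c; d]].
  move=> -> ->; apply/seteqP; split=> y /=; rewrite !inE.
    by case=> ->; rewrite eqxx ?orbT.
  by move=> /orP[]/eqP->; [left|right].
case: k => [[[] []] []] /=.
- by rewrite (@succs_high _ (1 - _)); [apply: set1E|]; lra.
- by rewrite (@succs_low _ (_ / 5)); [apply: set1E|]; lra.
- by rewrite (@succs_high _ (1 - _)); [apply: set1E|]; lra.
- by rewrite (@succs_low _ (_ / 5)); [apply: set1E|]; lra.
- by rewrite (@succs_low _ (1 - _)); [apply: set1E|]; lra.
- by rewrite (@succs_high _ (_ / 5)); [apply: set1E|]; lra.
- by rewrite (@succs_mid _ (1 - _)); [apply: set2E|]; lra.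
- by rewrite (@succs_mid _ (_ / 5)) 1?setUC; [apply: set2E|]; lra.
Qed.

Lemma point_itv k : 0 <= point k <= 1.
Proof.
have /andP[h1 h2] := tau_bounds R.
by case: k => [[[] []] []] /=; apply/andP; split; lra.
Qed.

(** The two branches come back to a branching point after two and four steps. The resulting
    recursion is also satisfied by the powers of [s], since [s ^+ 4 = s ^+ 2 + 1]; the factor 1 / 3
    covers [n < 4]. *)
Lemma num_successors_point_lower n r :
  1 / 3 * s ^+ n <= (f n (point (false, false, r)))%:R.
Proof.
have /andP[s1 s2] := sqrt_tau_bounds R; have ss := sqrt_tau_sqr R.
have h3 := tau_sqr R.
elim/ltn_ind: n r => n IH r; have [n4|n4] := ltnP n 4.
  apply: (@le_trans _ _ 1); last by rewrite ler1n num_successors_gt0 // point_itv.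
  have : s ^+ n <= s ^+ 3 by apply: ler_weXn2l => //; lra.
  have -> : s ^+ 3 = t * s by rewrite exprS expr2 ss mulrC.
  have : t * s <= 3 by have /andP[? ?] := tau_bounds R; nra.
  lra.
case: n n4 IH => [//|[//|[//|[//|n]]]] _ IH.
have -> : f n.+4 (point (false, false, r)) =
    (f n.+2 (point (false, false, ~~ r)) + f n (point (false, false, r)))%N.
  by do 4![rewrite ?num_successors_point /= ?big_cons ?big_nil ?addn0 ?negbK].
have -> : s ^+ n.+4 = s ^+ n.+2 + s ^+ n.
  have -> : s ^+ n.+4 = s * s * (s * s) * s ^+ n by rewrite !exprS; ring.
  have -> : s ^+ n.+2 = s * s * s ^+ n by rewrite !exprS; ring.
  by rewrite ss h3 mulrDl mul1r.
have a := IH n.+2 (leqW (leqnn _)) (~~ r).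
have b := IH n (leqW (leqW (leqW (leqnn _)))) r.
by rewrite natrD; lra.
Qed.

Lemma growth_rate_golden : growth_rate ((2 * t - 1) / 5) s.
Proof.
apply: (@cvg_root _ id _ (1 / 3) 15) => //.
apply: nearW => n; apply/andP; split.
  exact: (num_successors_point_lower n false).
exact/num_successors_upper/(point_itv (false, false, false)).
Qed.

Local Notation x := ((2 * t - 1) / 5).
Local Notation N := (orbit_network x).

Lemma edge_point r k y :
  edge (orbit_network r) (point k) y = (y \in map point (successors_of k)).
Proof.
have e : succs [set point k] y <-> y \in map point (successors_of k).
  by rewrite succs_point.
apply/(edgeP r)/idP.
  by move=> [i di ei]; apply/e; exists (point k) => //; exists i.
by move/e => [_ -> [i di ei]]; exists i.
Qed.

Lemma edge_points r k l :
  edge (orbit_network r) (point k) (point l) = index_edge k l.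
Proof. by rewrite edge_point (mem_map point_inj). Qed.

Lemma orbit_points : orbit_set x = range point.
Proof.
apply/seteqP; split=> [y [n _]|y [k _ <-]].
  elim: n y => [|n IH] y; first by move=> ->; exists (false, false, false).
  move=> [_ /IH[k _ <-] [i di ->]].
  have /mapP[l _ ->] : g i (point k) \in map point (successors_of k).
    by rewrite -(edge_point x); apply/(edgeP x); exists i.
  by exists l.
have A : orbit_set x (point (false, false, false)) by exists 0%N.
have next k' l : orbit_set x (point k') -> index_edge k' l ->
    orbit_set x (point l).
  by move=> hk; rewrite -(edge_points x); exact: orbit_edge.
have B := next _ (false, true, false) A isT.
have C := next _ (true, false, false) A isT.
have D := next _ (true, true, false) C isT.
have E := next _ (false, false, true) B isT.
have F := next _ (false, true, true) E isT.
have G := next _ (true, false, true) E isT.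
have H := next _ (true, true, true) G isT.
by case: k => [[[] []] []].
Qed.

Lemma min_cycle_points (c : seq orbit_index) :
  c != [::] -> uniq c -> cycle index_edge c -> min_cycle N (map point c).
Proof.
move=> c0 uc cc; split.
- by case: (c) c0.
- by move=> _ /mapP[k _ ->]; rewrite /= orbit_points; exists k.
- by rewrite (map_inj_uniq point_inj).
- by rewrite (mono_cycle (e := index_edge)) // => k l; exact: edge_points.
Qed.

Lemma min_cycle_preimage (d : seq R) : min_cycle N d ->
  exists n l, l \in [:: short_loop false; short_loop true; long_loop false] /\
              rot n d = map point l.
Proof.
move=> [d0 dV ud cd].
have [c ec] : exists c, d = map point c.
  elim: d dV {d0 ud cd} => [_|y d IH dV]; first by exists [::].
  have [|c ->] := IH; first by move=> u ud; apply: dV; rewrite inE ud orbT.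
  have := dV y (mem_head _ _); rewrite /= orbit_points => -[k _ <-].
  by exists (k :: c).
have [|||n hn] := @index_cycle_classes c.
- by move: d0; rewrite ec; case: (c).
- by move: ud; rewrite ec (map_inj_uniq point_inj).
- move: cd; rewrite ec (mono_cycle (e := index_edge)) // => k l.
  exact: edge_points.
by exists n, (rot n c); rewrite ec map_rot.
Qed.

Lemma min_cycle_loop l :
  l \in [:: short_loop false; short_loop true; long_loop false] ->
  min_cycle N (map point l).
Proof.
by rewrite !inE => /or3P[]/eqP->; apply: min_cycle_points.
Qed.

Lemma golden_cycle_mixture : cycle_mixture 4 N.
Proof.
split.
- by rewrite /= orbit_points; apply: finite_image;
  exact: (@finite_finset (bool * bool * bool)%type).
- move=> d /min_cycle_preimage[n [l [hl el]]].
  rewrite -(size_rot n) el size_map.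
  by move: hl; rewrite !inE => /or3P[]/eqP->.
move=> y z; rewrite /= orbit_points => -[k _ <-] [l _ <-].
rewrite -[X in is_true X]/(edge N (point k) (point l)) edge_points => kl.
(* Each kind of edge is completed to a cycle of length 4. *)
have [c uc cc] : exists2 c, uniq [:: k, l & c] & cycle index_edge [:: k, l & c].
  case: k kl => [[[] []] r]; rewrite /index_edge !inE;
    [move=> /eqP->|move=> /eqP->|move=> /eqP->|move=> /orP[]/eqP->].
  - by exists [:: (false, false, r); (true, false, r)]; case: r.
  - by exists [:: (false, true, ~~ r); (false, false, r)]; case: r.
  - by exists [:: (true, false, ~~ r); (true, true, ~~ r)]; case: r.
  - by exists [:: (false, false, ~~ r); (false, true, ~~ r)]; case: r.
  - by exists [:: (true, true, r); (false, true, ~~ r)]; case: r.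
exists (map point [:: k, l & c]); first exact: min_cycle_points.
by apply/mem_cycle_edges; rewrite mem_head /= eqxx.
Qed.

Lemma golden_min_cycles : min_cycles N #= `I_3.
Proof.
pose loops := [:: short_loop false; short_loop true; long_loop false].
pose cyc l := cycle_edges (map point l).
have -> : min_cycles N = cyc @` [set` loops].
  apply/seteqP; split=> [_ [d md <-]|D [l hl <-]]; last first.
    by exists (map point l) => //; exact: min_cycle_loop.
  have [n [l [hl el]]] := min_cycle_preimage md.
  have [_ _ ud _] := md.
  by exists l => //; rewrite /cyc -el cycle_edges_rot.
apply: card_eq_trans (card_set_uniq_seq (s := loops) _) => //.
apply: inj_card_eq => l m; rewrite !inE /cyc => hl hm /cycle_edges_mem e.
have {}e k : (k \in l) = (k \in m) by rewrite -!(mem_map point_inj).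
(* Each short loop contains exactly one of these two indices, the long loop neither. *)
have := e (true, false, false); have := e (true, false, true).
by case/or4P: hl => [/eqP->|/eqP->|/eqP->|//];
  case/or4P: hm => [/eqP->|/eqP->|/eqP->|//].
Qed.

(** The two short loops are disjoint. *)
Lemma golden_no_root : ~ exists r, root_vertex N r.
Proof.
move=> [r [_ hr]].
have := hr _ (@min_cycle_loop (short_loop false) isT).
have := hr _ (@min_cycle_loop (short_loop true) isT).
by move=> /mapP[k hk ->]; rewrite (mem_map point_inj); case: k hk => [[[] []] []].
Qed.

Lemma golden_point_sqrt5 : x = (Num.sqrt 5)^-1 :> R.
Proof.
have h5 : Num.sqrt 5 * Num.sqrt 5 = 5 :> R by rewrite -expr2 sqr_sqrtr.
have n0 : Num.sqrt 5 != 0 :> R by rewrite sqrtr_eq0 -ltNge.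
apply: (mulfI n0); rewrite divff // /tau; lra.
Qed.

End GoldenMean.

(** * Prime mixtures for all odd periods and the maximum growth rate *)

Lemma return_point_mixture (R : realType) (k : nat) (z : R) : (1 <= k)%N ->
  let p := (2 * k - 1)%N in
  0 <= z <= 1 -> generation p z = [set z] ->
  (forall q, (0 < q < p)%N -> ~ generation q z z) ->
  (forall q, (0 < q < p)%N ->
    exists a b : R, a != b /\ generation q z = [set a; b]) ->
  num_successors p z = fib k.+1 ->
  [/\ prime_cycle_mixture p (orbit_network z),
      vertices (orbit_network z) #= `I_(4 * k - 3)%N,
      min_cycles (orbit_network z) #= `I_(fib k.+1) &
      network_growth_rate (orbit_network z) (rho R k)].
Proof.
move=> k1 p z01 gp glt gpair succ.
have p0 : (0 < p)%N by rewrite /p; lia.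
split.
- exact: orbit_prime_cycle_mixture.
- have -> : (4 * k - 3 = 2 * p - 1)%N by rewrite /p; lia.
  exact: card_orbit.
- by rewrite -succ; exact: card_min_cycles.
- exists z; first exact: (root_vertex_return p0 gp).
  by rewrite /rho -succ; exact: growth_rate_return.
Qed.

Lemma exists_prime_mixture (R : realType) (k : nat) : (1 <= k)%N ->
  exists2 x : R, 0 <= x <= 1 &
    [/\ prime_cycle_mixture (2 * k - 1)%N (orbit_network x),
        vertices (orbit_network x) #= `I_(4 * k - 3)%N,
        min_cycles (orbit_network x) #= `I_(fib k.+1) &
        network_growth_rate (orbit_network x) (rho R k)].
Proof.
have /andP[h1 h2] := tau_bounds R.
case: k => [//|[_|j _]].
  (* For [k = 1] the fixed point 0 with its loop serves; [k = j + 2] uses an itinerary of length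
     [j]. *)
  exists 0; first by rewrite lexx ler01.
  apply: return_point_mixture => //; first by rewrite lexx ler01.
  - rewrite /generation /= (@succs_low _ 0) ?mulr0 //; lra.
  - by case=> [|[]].
  - by case=> [|[]].
  - exact: num_successors_at0.
have [z [y it]] := exists_itinerary R j.
have /andP[z1 z2] := itinerary_z_bounds it.
have pE : (2 * j.+2 - 1 = 2 * j + 3)%N by lia.
have z01 : 0 <= z <= 1 by lra.
exists z => //; apply: return_point_mixture => //; rewrite pE.
- exact: itinerary_return it.
- exact: itinerary_no_early_return it.
- exact: itinerary_pairs it.
- exact: itinerary_num_successors it.
Qed.

Theorem theorem6 (R : realType) :
  [/\ (forall k : nat, (1 <= k)%N ->
         exists2 x : R, 0 <= x <= 1 &
           [/\ prime_cycle_mixture (2 * k - 1)%N (orbit_network x),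
               vertices (orbit_network x) #= `I_(4 * k - 3)%N,
               min_cycles (orbit_network x) #= `I_(fib k.+1) &
               network_growth_rate (orbit_network x) (rho R k)]),
      rho R k @[k --> \oo] --> Num.sqrt (tau R),
      max_growth_rate (Num.sqrt (tau R)) &
      (2 * tau R - 1) / 5 = (Num.sqrt 5)^-1 /\
      (let x : R := (2 * tau R - 1) / 5 in
       [/\ 0 <= x <= 1,
           growth_rate x (Num.sqrt (tau R)),
           cycle_mixture 4 (orbit_network x),
           min_cycles (orbit_network x) #= `I_3 &
           ~ (exists r, root_vertex (orbit_network x) r)])].
Proof.
have x01 : 0 <= (2 * tau R - 1) / 5 <= 1.
  exact: (point_itv R (false, false, false)).
split.
- exact: exists_prime_mixture.
- exact: cvg_rho.
- split; last exact: growth_rate_le_sqrt_tau.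
  by exists ((2 * tau R - 1) / 5); last exact: growth_rate_golden.
split; first exact: golden_point_sqrt5.
split=> //.
- exact: growth_rate_golden.
- exact: golden_cycle_mixture.
- exact: golden_min_cycles.
- exact: golden_no_root.
Qed.
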